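(* Let $\tilde{\mathbf p}$ and $\tilde{\mathbf q}$ be extended Kostant pictures (for $\mathsf{GL}_n$), with corresponding MV-cycles $M(\tilde{\mathbf p})$ and $M(\tilde{\mathbf q})$. Write their convolution product as $M(\tilde{\mathbf p})*M(\tilde{\mathbf q})=\sum_{\tilde{\mathbf r}}c_{\tilde{\mathbf r}}\,M(\tilde{\mathbf r})$, the sum being over extended Kostant pictures $\tilde{\mathbf r}$. Then $c_{\tilde{\mathbf r}}=0$ for every $\tilde{\mathbf r}$ with $\tilde{\mathbf r}>\tilde{\mathbf p}+\tilde{\mathbf q}$.
   Context: **Lattices.** Fix $n$. Let $X$ be the complex vector space with basis $t^je_i$ ($1\le i\le n$, $j\in\mathbb Z$), and let $t$ be the linear operator $t\cdot t^je_i=t^{j+1}e_i$. Let $X_0=\mathrm{span}\{t^je_i: j\ge0\}$. The affine Grassmannian $\mathbf{Gr}$ of $\mathsf{GL}_n$ is the set of lattices, i.e. subspaces $Y\subset X$ with $tY\subseteq Y$ and $t^kX_0\subseteq Y\subseteq t^{-k}X_0$ for some $k$; for fixed $k$ these form a projective variety, and $\mathbf{Gr}$ is the increasing union of these. Coweights are elements $\lambda\in\mathbb Z^n$; put $\underline\lambda=\mathrm{span}\{t^je_i: j\ge-\lambda_i\}$. A coweight $\nu$ acts on $X$ by $\nu\cdot t^je_i=t^{j-\nu_i}e_i$ and so on $\mathbf{Gr}$ (shift by $\nu$). The torus $(\mathbb C^* )^n$ acts on $X$, $(z_1,\dots,z_n)$ multiplying each $t^je_i$ by $z_i$. **MV-cycles.**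 A lattice $Y$ has highest coweight $\lambda$ and lowest coweight $\mu$ if $\lim_{z\to0}(1,z,\dots,z^{n-1})\cdot Y=\underline\lambda$ and $\lim_{z\to\infty}(1,z,\dots,z^{n-1})\cdot Y=\underline\mu$. Let $S_\lambda$ (resp. $T_\mu$) be the set of lattices with highest coweight $\lambda$ (resp. lowest coweight $\mu$). MV-cycles with highest coweight $\lambda$ and lowest coweight $\mu$ are the irreducible components of $\overline{S_\lambda\cap T_\mu}$ (this intersection is pure dimensional). **Kostant pictures.** A loop is an interval of columns $\{\ell,\ell+1,\dots,r\}$ with $1\le\ell<r\le n$ (left end $\ell$, right end $r$; it passes through columns $\ell,\dots,r$). A Kostant picture $\mathbf p$ is a finite multiset of loops. An extended Kostant picture is a pair $\tilde{\mathbf p}=(\mathbf p,\eta)$ with $\eta\in\mathbb Z^n$. Sum: $(\mathbf p,\eta)+(\mathbf q,\eta')=(\mathbf p+\mathbf q,\eta+\eta')$, where $\mathbf p+\mathbf q$ is the multiset sum of the loops. **Partial order.** Two loops $A,B$ of $\tilde{\mathbf p}=(\mathbf p,\eta)$ overlap if neither interval contains the other and they pass through at least one common column. The fusion of overlapping loops $A,B$ replaces them by the loops $A\cup B$ and $A\cap B$ (union and intersection of column intervals); if $A\cap B$ is a single column $i$, then instead of adding a loop $A\cap B$ one increases $\eta_i$ by $1$. Write $\tilde{\mathbf p}\ge\tilde{\mathbf q}$ if $\tilde{\mathbf q}$ is obtained from $\tilde{\mathbf p}$ by a (possibly empty) sequence of fusions, and $\tilde{\mathbf p}>\tilde{\mathbf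 q}$ if moreover $\tilde{\mathbf p}\neq\tilde{\mathbf q}$; this is a partial order. **Parametrization (known).** For $1\le i\le j\le n$ let $V_{i,j}=\mathrm{span}\{t^ke_a: i\le a\le j,\ k\in\mathbb Z\}$. A lattice $Y$ is weakly compatible to $(\mathbf p,\eta)$ if for all $i<j$ the number of loops of $\mathbf p$ with left end $i$ and right end $j$ equals $\dim\big((Y\cap V_{i,j})/((Y\cap V_{i+1,j})+(Y\cap V_{i,j-1}))\big)$, and $\underline\eta$ is the span of all basis vectors $t^je_i$ contained in $Y$. Let $M(\tilde{\mathbf p})$ be the closure of the set of lattices weakly compatible to $\tilde{\mathbf p}$. It is a known theorem that $\tilde{\mathbf p}\mapsto M(\tilde{\mathbf p})$ is a bijection from extended Kostant pictures to MV-cycles. **Convolution.** Let $\mathbf{Gr}_0$ be the set of lattices containing $X_0$. Let $\widetilde X$ be the space of all formal, possibly infinite, linear combinations of the $t^je_i$; for $s\in\mathbb C$ let $\frac1{t-s}=\frac1t(1+\frac st+\frac{s^2}{t^2}+\cdots)$. For $s\in\mathbb C^*$ and $Y\in\mathbf{Gr}_0$ let $\tau_s(Y)\subset\widetilde X$ be the image of $Y$ under $t^je_i\mapsto(t-s)^je_i$ ($j\in\mathbb Z$). For MV-cycles $M,N\subset\mathbf{Gr}_0$ let $M*_{\mathbb C}N$ be the closure of the family of pairs $(s,\,Y_1+\tau_s(Y_2))$ with $s\in\mathbb C^*$, $Y_1\in M$, $Y_2\in N$. Here the subspaces $Y_1+\tau_s(Y_2)$ all lie between $X_0$ and $t^{-k}(t-s)^{-k}X_0$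 for some fixed large $k$, and the quotients $t^{-k}(t-s)^{-k}X_0/X_0$ form a trivial vector bundle of rank $2nk$ over $s\in\mathbb C$ with basis $t^a t^{-k}(t-s)^{-k}e_i$, $0\le a<2k$; the closure is taken in the corresponding Grassmannian bundle over $\mathbb C$. (This is a lattice model for the Beilinson-Drinfeld Grassmannian.) The fiber of $M*_{\mathbb C}N$ over each $s\ne0$ is isomorphic to $M\times N$; the fiber over $0$ lies in $\mathbf{Gr}_0$ and its top-dimensional components are MV-cycles $K$, whose highest (lowest) coweight is the sum of the highest (lowest) coweights of $M$ and $N$. Put $M*N=\sum_K c_{MN}^K K$, where $c_{MN}^K$ is the multiplicity of $K$ in the scheme-theoretic fiber over $0$. For arbitrary MV-cycles, define the product by shifting into $\mathbf{Gr}_0$, using $(\alpha\cdot M)*(\beta\cdot N)=(\alpha+\beta)\cdot(M*N)$ for coweights $\alpha,\beta$. *)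

(* Defs.v *)
From HB Require Import structures.
From Stdlib Require Relation_Operators.
From mathcomp Require Import all_boot all_order all_algebra.
From mathcomp Require Import finmap multiset complex.
From mathcomp Require Import all_classical all_reals all_analysis.
From mathcomp Require mpoly.
Import (canonicals, coercions) mpoly.

Set Implicit Arguments.
Unset Strict Implicit.
Unset Printing Implicit Defensive.

Import Order.TTheory GRing.Theory Num.Theory.

Local Open Scope classical_set_scope.
Local Open Scope ring_scope.

Definition vsubspace (F : fieldType) (V : lmodType F) (S : set V) : Prop :=
  S 0 /\ forall (a : F) (u v : V), S u -> S v -> S (a *: u + v).

Definition lspan (F : fieldType) (V : lmodType F) (S : set V) : set V :=
  smallest (@vsubspace F V) S.

Definition sumset (F : fieldType) (V : lmodType F) (A B : set V) : set V :=
  [set a + b | a in A & b in B].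

(** [dim (A / B) = m] for subspaces [B `<=` A], possibly infinite-dimensional:
    some [m] vectors of [A] form a basis of [A] modulo [B]. *)
Definition quotient_dim (F : fieldType) (V : lmodType F) (A B : set V)
    (m : nat) : Prop :=
  exists v : 'I_m -> V, (forall i, A (v i)) /\
    forall a, A a -> exists! c : 'rV[F]_m, B (a - \sum_i c 0 i *: v i).

(** The space of formal, possibly infinite, combinations of the [t^j e_i]:
    the coefficient of [t^j e_i] in [f] is [f j 0 i]. Columns are numbered
    from [0] to [n - 1]. *)
Definition formal (R : realType) (n : nat) : Type := int -> 'rV[R[i]]_n.
HB.instance Definition _ (R : realType) (n : nat) :=
  GRing.Lmodule.on (formal R n).

Definition tbasis (R : realType) (n : nat) (j : int) (i : 'I_n) : formal R n :=
  fun m => if m == j then delta_mx 0 i else 0.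

Definition tpow (R : realType) (n : nat) (d : int) (f : formal R n) :
  formal R n := fun m => f (m - d).

Definition coweight (n : nat) : Type := {ffun 'I_n -> int}.
HB.instance Definition _ (n : nat) := GRing.Zmodule.on (coweight n).

Definition cwshift (R : realType) (n : nat) (nu : coweight n) (f : formal R n) :
  formal R n := fun m => \row_i f (m + nu i) 0 i.

(** The lattice [\underline\lambda]. *)
Definition clattice (R : realType) (n : nat) (la : coweight n) :
    set (formal R n) :=
  lspan [set f | exists (j : int) (i : 'I_n), - la i <= j /\ f = tbasis R j i].
Arguments clattice R {n} la.

Definition X0 (R : realType) (n : nat) : set (formal R n) :=
  clattice R (0 : coweight n).
Arguments X0 R n : clear implicits.

(** [t^d X_0] *)
Definition tX0 (R : realType) (n : nat) (d : int) : set (formal R n) :=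
  tpow d @` X0 R n.
Arguments tX0 R n d : clear implicits.

Definition is_lattice (R : realType) (n : nat) (Y : set (formal R n)) : Prop :=
  [/\ vsubspace Y, tpow 1 @` Y `<=` Y &
      exists k : nat, tX0 R n k%:Z `<=` Y /\ Y `<=` tX0 R n (- k%:Z)].

Definition Gr (R : realType) (n : nat) : set (set (formal R n)) :=
  [set Y | is_lattice Y].
Arguments Gr R n : clear implicits.

Definition shift_family (R : realType) (n : nat) (nu : coweight n)
    (M : set (set (formal R n))) : set (set (formal R n)) :=
  [set cwshift nu @` Y | Y in M].

(** A set of points covered by affine spaces. Only points lying in the image of
    some chart matter below. *)
Record atlas (F : fieldType) (P : Type) := Atlas {
  chart_ix : Type;
  chart_var : chart_ix -> finType;
  chart : forall i : chart_ix, (chart_var i -> F) -> P }.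

Notation polys F K := (mpoly.mpoly #|K| F).

Definition peval (F : fieldType) (K : finType) (v : K -> F) (f : polys F K) : F :=
  mpoly.meval (fun i => v (enum_val i)) f.

Definition pvar (F : fieldType) (K : finType) (x : K) : polys F K :=
  mpoly.mpolyX F (mpoly.mnm1 (enum_rank x)).

Definition zclosed (F : fieldType) (P : Type) (A : atlas F P) (W : set P) :
    Prop :=
  forall i : chart_ix A, exists E : set (polys F (chart_var i)),
  forall v, W (chart v) <-> forall f, E f -> peval v f = 0.

Definition zclosure (F : fieldType) (P : Type) (A : atlas F P) (W : set P) :
  set P := smallest (@zclosed F P A) W.

Definition zirreducible (F : fieldType) (P : Type) (A : atlas F P)
    (W : set P) : Prop :=
  W !=set0 /\
  forall U V : set P, zclosed A U -> zclosed A V ->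
    W `<=` U `|` V -> W `<=` U \/ W `<=` V.

Definition irreducible_component (F : fieldType) (P : Type) (A : atlas F P)
    (W K : set P) : Prop :=
  [/\ K `<=` W, zirreducible A K &
      forall K' : set P, K' `<=` W -> zirreducible A K' -> K `<=` K' -> K' = K].

(** Supremum of a set of natural numbers, with value in the extended reals of
    [R] since it may be infinite. *)
Definition nat_sup (R : realType) (S : set nat) : \bar R :=
  ereal_sup [set (m%:R)%:E | m in S].

(** Krull dimension of a closed set (-oo when it is empty). *)
Definition zdim (R : realType) (F : fieldType) (P : Type) (A : atlas F P)
    (W : set P) : \bar R :=
  nat_sup R [set m | exists C : nat -> set P,
    (forall l, (l <= m)%N ->
       [/\ zclosed A (C l), zirreducible A (C l) & C l `<=` W]) /\
    (forall l, (l < m)%N -> C l `<` C l.+1)].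

Definition vanishing (F : fieldType) (P : Type) (A : atlas F P) (W : set P)
    (i : chart_ix A) : set (polys F (chart_var i)) :=
  [set f | forall v, W (chart v) -> peval v f = 0].
Arguments vanishing {F P A} W {i}.

(** The local ring of the closed reduced [Z] at the generic point of an
    irreducible [K] contained in [Z], computed in the chart [i], consists of the
    fractions [f / g] with [g] not vanishing identically on [K], represented by
    the pairs [(f, g)]; [frac_eq] is equality of fractions over the coordinate
    ring of [Z]. *)
Definition fractions (F : fieldType) (P : Type) (A : atlas F P) (K : set P)
    (i : chart_ix A) : set (polys F (chart_var i) * polys F (chart_var i)) :=
  [set x | ~ vanishing K x.2].
Arguments fractions {F P A} K {i}.

Definition frac_eq (F : fieldType) (P : Type) (A : atlas F P) (Z K : set P)
    (i : chart_ix A) (x y : polys F (chart_var i) * polys F (chart_var i)) :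
    Prop :=
  exists h, ~ vanishing K h /\ vanishing Z (h * (x.1 * y.2 - y.1 * x.2)).

Definition local_ideal (F : fieldType) (P : Type) (A : atlas F P)
    (Z K : set P) (i : chart_ix A)
    (b : set (polys F (chart_var i) * polys F (chart_var i))) : Prop :=
  [/\ b `<=` fractions K,
      forall x y, b x -> fractions K y -> frac_eq Z K x y -> b y,
      b (0, 1),
      forall x y, b x -> b y -> b (x.1 * y.2 + y.1 * x.2, x.2 * y.2) &
      forall x y, fractions K x -> b y -> b (x.1 * y.1, x.2 * y.2)].

(** Multiplicity of [K] in the scheme-theoretic zero locus on [Z] of the regular
    function given by [f i] in the chart [i]: the length of the quotient of the
    local ring of [Z] at [K] by [f]. The submodules of this quotient are the
    ideals containing [f]. The result does not depend on the chart, as long as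
    it meets [K]. *)
Definition multiplicity (R : realType) (F : fieldType) (P : Type)
    (A : atlas F P) (Z : set P)
    (f : forall i : chart_ix A, polys F (chart_var i)) (K : set P) : \bar R :=
  nat_sup R [set m | exists i : chart_ix A, (exists v, K (@chart _ _ A i v)) /\
    exists b : nat -> set (polys F (chart_var i) * polys F (chart_var i)),
      (forall l, (l <= m)%N -> local_ideal Z K (b l) /\ b l (f i, 1)) /\
      (forall l, (l < m)%N -> b l `<` b l.+1)].

(** The standard charts of the Grassmannian of subspaces between [E] and
    [E + span b], for a family [b] linearly independent modulo [E]: for a set
    [J] of indices, the chart [J] consists of the subspaces
      [E + span {b_x + \sum_(y \notin J) v_(x, y) b_y | x \in J}]. *)
Definition cells (I : finType) (J : {set I}) : finType :=
  {z : I * I | (z.1 \in J) && (z.2 \notin J)}.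

Definition chart_space (F : fieldType) (V : lmodType F) (E : set V)
    (I : finType) (b : I -> V) (J : {set I}) (v : cells J -> F) : set V :=
  sumset E (lspan [set b x + \sum_(z : cells J | (val z).1 == x)
                               v z *: b (val z).2 | x in [set` J]]).

(** The affine Grassmannian: the charts with first index [k] cover the
    subspaces between [t^k X_0] and [t^-k X_0]. Being a lattice is a closed
    condition there, so a set of lattices is [zclosed] if and only if its
    intersection with each of these projective varieties is closed. *)
Definition Gr_atlas (R : realType) (n : nat) : atlas R[i] (set (formal R n)) :=
  @Atlas R[i] (set (formal R n))
    {k : nat & {set 'I_n * 'I_(2 * k)}}
    (fun J => cells (projT2 J))
    (fun J v =>
       chart_space (tX0 R n (projT1 J)%:Z)
         (fun x : 'I_n * 'I_(2 * projT1 J) =>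
            tbasis R (x.2%:Z - (projT1 J)%:Z) x.1) v).

Definition loop (n : nat) : Type := {x : 'I_n * 'I_n | (x.1 < x.2)%N}.
HB.instance Definition _ (n : nat) := Finite.on (loop n).

Definition lend (n : nat) (A : loop n) : 'I_n := (val A).1.
Definition rend (n : nat) (A : loop n) : 'I_n := (val A).2.

Definition columns (n : nat) (A : loop n) : {set 'I_n} :=
  finset (fun c : 'I_n => (lend A <= c <= rend A)%N).

Definition overlap (n : nat) (A B : loop n) : bool :=
  [&& ~~ (columns A \subset columns B), ~~ (columns B \subset columns A)
    & columns A :&: columns B != finset.set0].

Definition kpicture (n : nat) : Type := ({mset (loop n)})%mset.
HB.instance Definition _ (n : nat) := Choice.on (kpicture n).

Definition ekpicture (n : nat) : Type := (kpicture n * coweight n)%type.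

Definition ekp_add (n : nat) (p q : ekpicture n) : ekpicture n :=
  ((p.1 `+` q.1)%mset, p.2 + q.2).

(** [q] is obtained from [p] by one fusion. *)
Definition fusion (n : nat) (p q : ekpicture n) : Prop :=
  exists (p0 : kpicture n) (A B U : loop n),
    [/\ overlap A B, p.1 = (p0 `+` [mset A; B])%mset,
        columns U = columns A :|: columns B &
        (exists D : loop n,
          [/\ columns D = columns A :&: columns B,
              q.1 = (p0 `+` [mset U; D])%mset & q.2 = p.2]) \/
        (exists i : 'I_n,
          [/\ columns A :&: columns B = finset.set1 i,
              q.1 = (p0 `+` [mset U])%mset &
              q.2 = p.2 + [ffun j => (j == i)%:Z]])].

Definition ekp_ge (n : nat) (p q : ekpicture n) : Prop :=
  Relation_Operators.clos_refl_trans _ (@fusion n) p q.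

Definition ekp_gt (n : nat) (p q : ekpicture n) : Prop :=
  ekp_ge p q /\ p <> q.

Definition Vcols (R : realType) (n : nat) (i j : nat) : set (formal R n) :=
  lspan [set f | exists (k : int) (a : 'I_n),
                   (i <= a <= j)%N /\ f = tbasis R k a].
Arguments Vcols R {n} i j.

Definition weakly_compatible (R : realType) (n : nat) (p : ekpicture n)
    (Y : set (formal R n)) : Prop :=
  (forall A : loop n,
     quotient_dim (Y `&` Vcols R (lend A) (rend A))
       (sumset (Y `&` Vcols R (lend A).+1 (rend A))
               (Y `&` Vcols R (lend A) (rend A).-1))
       (p.1 A)) /\
  clattice R p.2 =
    lspan (Y `&` [set tbasis R j i | j in [set: int] & i in [set: 'I_n]]).

Definition MVcycle (R : realType) (n : nat) (p : ekpicture n) :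
    set (set (formal R n)) :=
  zclosure (Gr_atlas R n) (Gr R n `&` [set Y | weakly_compatible p Y]).
Arguments MVcycle R {n} p.

Definition tsub (R : realType) (n : nat) (s : R[i]) (f : formal R n) :
  formal R n := fun m => f (m - 1) - s *: f m.

(** Multiplication by [1/(t-s) = \sum_(a >= 0) s^a t^(-1-a)]. On the series
    used here, whose exponents are bounded above, the sum has finite support. *)
Definition tsub_inv (R : realType) (n : nat) (s : R[i]) (f : formal R n) :
    formal R n :=
  fun m => \sum_(a \in [set: nat]) s ^+ a *: f (m + 1 + a%:Z).

(** Multiplication by [(t-s)^j]. *)
Definition tsub_exp (R : realType) (n : nat) (s : R[i]) (j : int)
    (f : formal R n) : formal R n :=
  match j with
  | Posz d => iter d (tsub s) f
  | Negz d => iter d.+1 (tsub_inv s) f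
  end.

(** [tau_s] on vectors of [X], which have finite support. *)
Definition tau (R : realType) (n : nat) (s : R[i]) (f : formal R n) :
    formal R n :=
  \sum_(j \in [set: int]) \sum_(i < n) f j 0 i *: tsub_exp s j (tbasis R 0 i).

(** The Grassmannian bundle over the line with coordinate [s], whose fiber
    over [s] consists of the subspaces between [X_0] and
    [t^-k (t-s)^-k X_0]. The coordinate [s] is the variable [None]. *)
Definition BD_frame (R : realType) (n k : nat) (s : R[i])
    (x : 'I_n * 'I_(2 * k)) : formal R n :=
  tpow x.2%:Z (tpow (- k%:Z) (tsub_exp s (- k%:Z) (tbasis R 0 x.1))).

Definition BD_atlas (R : realType) (n k : nat) :
    atlas R[i] (R[i] * set (formal R n)) :=
  @Atlas R[i] (R[i] * set (formal R n))%type
    {set 'I_n * 'I_(2 * k)}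
    (fun J => option (cells J))
    (fun J v => (v None, chart_space (X0 R n) (BD_frame (v None))
                           (fun z : cells J => v (Some z)))).

(** [M *_C N], for [M] and [N] contained in [Gr_0]. *)
Definition conv_family (R : realType) (n k : nat)
    (M N : set (set (formal R n))) : set (R[i] * set (formal R n)) :=
  zclosure (BD_atlas R n k)
    [set z | z.1 <> 0 /\ exists Y1 Y2 : set (formal R n),
       [/\ M Y1, N Y2 & z.2 = sumset Y1 (tau z.1 @` Y2)]].

Definition conv_fiber0 (R : realType) (n k : nat)
    (M N : set (set (formal R n))) : set (R[i] * set (formal R n)) :=
  conv_family k M N `&` [set z | z.1 = 0].

(** [c_{MN}^K], for [M] and [N] contained in [Gr_0]: the multiplicity of [K] in
    the scheme-theoretic fiber over [s = 0] if [K] is one of its top-dimensional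
    components, and [0] otherwise, [M * N] being a sum over these components
    only. *)
Definition conv_coef (R : realType) (n k : nat)
    (M N K : set (set (formal R n))) : \bar R :=
  let K0 : set (R[i] * set (formal R n)) := [set (0, Y) | Y in K] in
  if `[< irreducible_component (BD_atlas R n k) (conv_fiber0 k M N) K0 /\
         zdim R (BD_atlas R n k) K0 =
           zdim R (BD_atlas R n k) (conv_fiber0 k M N) >]
  then multiplicity R (conv_family k M N)
         (fun J : chart_ix (BD_atlas R n k) => pvar R[i] (None : option (cells J)))
         K0
  else 0%E.

Definition in_bounds (R : realType) (n k : nat) (M : set (set (formal R n))) :
    Prop :=
  forall Y, M Y -> X0 R n `<=` Y /\ Y `<=` tX0 R n (- k%:Z).

(* Main.v *)
Require Import Defs.
From HB Require Import structures.
From mathcomp Require Import all_boot all_order all_algebra.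
From mathcomp Require Import finmap multiset complex.
From mathcomp Require Import all_classical all_reals all_analysis.
From mathcomp Require Import zify ring.
From mathcomp Require mpoly.
Import (canonicals, coercions) mpoly.

(** For a lattice [Y] and columns [i <= j], consider the dimension of
    [Y] cut with [V_(i, j)], relative to that of [X_0]. On lattices weakly
    compatible to [(p, eta)] it takes the value
    [\sum_(i <= a <= j) eta_a] plus the number of loops of [p] contained in
    [i..j], by inclusion-exclusion on subintervals, so this value is a lower
    bound on all of [M(p, eta)] by semicontinuity. Relative dimensions add up in
    [Y_1 + tau_s(Y_2)], since principal parts at [0] and at [s <> 0] are
    independent; hence, again by semicontinuity, every point of the special
    fiber satisfies the lower bound attached to [p + q]. But a fusion of [A] and [B]
    never decreases these numbers and increases the one attached to the interval
    [A :&: B], so a lattice weakly compatible to some [r > p + q] violates one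
    of these bounds: [M(r)] is not even contained in the special fiber. *)

Set Implicit Arguments.
Unset Strict Implicit.
Unset Printing Implicit Defensive.

Import Order.TTheory GRing.Theory Num.Theory.

Local Open Scope classical_set_scope.
Local Open Scope ring_scope.

(** * Dimensions modulo a subspace *)

(** Lattices are infinite-dimensional, so the size of [Y] inside V_(i, j) is measured against a
    reference [clattice R la]: the dimension modulo the reference plus the correction [wsum la i j].
    The charts of [Gr_atlas] impose the references t^k X_0 for all k, and shifted cycles impose
    others; [rdim_ge_any] makes the choice immaterial. Semicontinuity is rank-nullity in a chart
    [J]: modulo the bottom space the subspace has dimension #|J|, and its part in V_(i, j) is the
    kernel of the projection to the other columns. A lower bound on the dimension of that part is an
    upper bound on a rank, that is, the vanishing of minors polynomial in the chart coordinates. One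
    computation serves both atlases because both frames are unitriangular with respect to the
    exponent of t. Lower bounds suffice on the cycles and on the family; the exact value is
    established only at weakly compatible lattices, where eta settles single columns and the
    quotient dimensions settle longer intervals by recursion. *)

Lemma vsub0 (F : fieldType) (V : lmodType F) (S : set V) :
  vsubspace S -> S 0.
Proof. by case. Qed.

Lemma vsubD (F : fieldType) (V : lmodType F) (S : set V) u v :
  vsubspace S -> S u -> S v -> S (u + v).
Proof. by move=> [_ h] Su Sv; rewrite -[u]scale1r; apply: h. Qed.

Lemma vsubZ (F : fieldType) (V : lmodType F) (S : set V) a u :
  vsubspace S -> S u -> S (a *: u).
Proof. by move=> [S0 h] Su; rewrite -[_ *: _]addr0; apply: h. Qed.

Lemma vsubB (F : fieldType) (V : lmodType F) (S : set V) u v :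
  vsubspace S -> S u -> S v -> S (u - v).
Proof.
move=> hS Su Sv; rewrite -scaleN1r; apply: vsubD => //; exact: vsubZ.
Qed.

Lemma vsub_sum (F : fieldType) (V : lmodType F) (S : set V) (I : Type)
    (r : seq I) (P : pred I) (f : I -> V) :
  vsubspace S -> (forall i, P i -> S (f i)) -> S (\sum_(i <- r | P i) f i).
Proof.
move=> hS hf; apply: (big_ind S) => [|u v|//]; first exact: vsub0.
exact: vsubD.
Qed.

Lemma vsubI (F : fieldType) (V : lmodType F) (A B : set V) :
  vsubspace A -> vsubspace B -> vsubspace (A `&` B).
Proof.
move=> [A0 hA] [B0 hB]; split=> // a u v [Au Bu] [Av Bv].
by split; [apply: hA|apply: hB].
Qed.

Lemma vsub_sumset (F : fieldType) (V : lmodType F) (A B : set V) :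
  vsubspace A -> vsubspace B -> vsubspace (sumset A B).
Proof.
move=> [A0 hA] [B0 hB]; split; first by exists 0 => //; exists 0; rewrite ?addr0.
move=> a _ _ [u Au [u' Bu' <-]] [v Av [v' Bv' <-]].
exists (a *: u + v); first exact: hA.
exists (a *: u' + v'); first exact: hB.
by rewrite scalerDr addrACA.
Qed.

Lemma lspan_vsub (F : fieldType) (V : lmodType F) (S : set V) :
  vsubspace (lspan S).
Proof.
split=> [T [[T0 _] _] //|a u v hu hv T hT].
by have [[_ h] _] := hT; apply: h; [apply: hu|apply: hv].
Qed.

Lemma lspan_min (F : fieldType) (V : lmodType F) (S T : set V) :
  vsubspace T -> S `<=` T -> lspan S `<=` T.
Proof. by move=> hT ST u; apply. Qed.

Lemma lspan_sub (F : fieldType) (V : lmodType F) (S : set V) : S `<=` lspan S.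
Proof. by move=> u Su T [_]; apply. Qed.

Definition indep_mod (F : fieldType) (V : lmodType F) (E : set V) (m : nat)
    (v : 'I_m -> V) : Prop :=
  forall c : 'rV[F]_m, E (\sum_i c 0 i *: v i) -> c = 0.

(** [E] need not lie in [S]: this is dim (S / (S cap E)) >= m. In the applications [S] is cut by a
    set of columns while [E] is a whole reference lattice. *)
Definition dim_ge (F : fieldType) (V : lmodType F) (S E : set V) (m : nat) :
    Prop :=
  exists v : 'I_m -> V, (forall i, S (v i)) /\ indep_mod E v.

Lemma dim_ge0 (F : fieldType) (V : lmodType F) (S E : set V) : dim_ge S E 0.
Proof. by exists (fun=> 0); split=> [[]|c _] //; rewrite thinmx0. Qed.

(** Modulo [E1] a relation loses its term in [b], so the other coefficients vanish; a multiple of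
    [b] remains, and [b] is free modulo [E0]. *)
Lemma dim_ge_extend (F : fieldType) (V : lmodType F) (S E0 E1 : set V) (b : V)
    (m : nat) :
    vsubspace E1 -> E0 `<=` E1 -> E1 b -> S b ->
    (forall a, E0 (a *: b) -> a = 0) ->
  dim_ge S E1 m -> dim_ge S E0 m.+1.
Proof.
move=> hE1 E01 E1b Sb b_free [v [Sv v_free]].
exists (fun i => if unlift ord0 i is Some j then v j else b); split.
  by move=> i; case: unliftP.
move=> c; rewrite big_ord_recl unlift_none.
under eq_bigr do rewrite liftK.
move=> hc; have c_lift : \row_j c 0 (lift ord0 j) = 0.
  apply: v_free; under eq_bigr do rewrite mxE.
  have -> : \sum_(i < m) c 0 (lift ord0 i) *: v i =
     (c 0 ord0 *: b + \sum_(i < m) c 0 (lift ord0 i) *: v i) - c 0 ord0 *: b.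
    by rewrite addrC addKr.
  by apply: vsubB => //; [apply: E01|apply: vsubZ].
have c0 j : c 0 (lift ord0 j) = 0.
  by move/matrixP: c_lift => /(_ 0 j); rewrite !mxE.
move: hc; rewrite big1 ?addr0 => [/b_free cb|i _]; last by rewrite c0 scale0r.
by apply/rowP=> i; rewrite mxE; case: (unliftP ord0 i) => [j|] ->.
Qed.

(** Inside [S], [E1] exceeds [E0] by at most the line of [b], so at most one vector is lost. If [c]
    is a nontrivial relation modulo [E1], the vector dropped is one with [c 0 l != 0]: any other
    relation is proportional to [c] modulo [E0], and one without the index [l] must then be zero. *)
Lemma dim_ge_contract (F : fieldType) (V : lmodType F) (S E0 E1 : set V) (b : V)
    (m : nat) :
    vsubspace S -> vsubspace E0 -> vsubspace E1 ->
    (forall y, S y -> E1 y -> exists a, E0 (y - a *: b)) ->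
  dim_ge S E0 m.+1 -> dim_ge S E1 m.
Proof.
move=> hS hE0 hE1 E1b [v [Sv v_free]].
have Sc (c : 'rV_(m.+1)) : S (\sum_i c 0 i *: v i).
  by apply: vsub_sum => // i _; apply: vsubZ.
have [/existsNP[c /not_implyP[E1c /eqP cN0]]|] := pselect (~ indep_mod E1 v);
  last first.
  move=> /contrapT v_free1; exists (fun i => v (lift ord0 i)); split=> // c hc.
  have : \row_i (if unlift ord0 i is Some j then c 0 j else 0) = 0.
    apply: v_free1; rewrite big_ord_recl mxE unlift_none scale0r add0r.
    by under eq_bigr do rewrite mxE liftK.
  by move=> /rowP h; apply/rowP=> i; have := h (lift ord0 i); rewrite !mxE liftK.
have [l cl] : exists l, c 0 l != 0 by apply/rV0Pn.
have [a ha] := E1b _ (Sc c) E1c.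
have aN0 : a != 0.
  apply: contraNneq cN0 => a0; apply/eqP/v_free.
  by rewrite a0 scale0r subr0 in ha.
exists (fun i => v (lift l i)); split=> // d hd.
pose d' : 'rV_(m.+1) := \row_i (if unlift l i is Some j then d 0 j else 0).
have d'E : \sum_i d 0 i *: v (lift l i) = \sum_i d' 0 i *: v i.
  rewrite (bigD1_ord l) //= mxE unlift_none scale0r add0r.
  by under [RHS]eq_bigr do rewrite mxE liftK.
rewrite d'E in hd; have [a' ha'] := E1b _ (Sc d') hd.
have : d' - (a' / a) *: c = 0.
  apply: v_free; have -> : \sum_i (d' - (a' / a) *: c) 0 i *: v i =
    (\sum_i d' 0 i *: v i - a' *: b)
      - (a' / a) *: (\sum_i c 0 i *: v i - a *: b).
    rewrite scalerBr scalerA mulfVK // opprB addrA subrK scaler_sumr -sumrB.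
    by apply: eq_bigr => i _; rewrite !mxE scalerBl scalerA.
  by apply: vsubB => //; apply: vsubZ.
move=> /rowP d'c; have := d'c l; rewrite !mxE unlift_none sub0r => /eqP.
rewrite oppr_eq0 mulf_eq0 (negPf cl) orbF => /eqP e.
by apply/rowP=> i; have := d'c (lift l i); rewrite !mxE liftK e mul0r subr0.
Qed.

(** * Dimensions as ranks of matrices *)

Lemma subspace_matrix (F : fieldType) (N : nat) (S : set 'rV[F]_N) :
  vsubspace S -> exists M : 'M[F]_N, forall c, S c <-> (c <= M)%MS.
Proof.
move=> hS.
pose P m := `[< exists M : 'M[F]_N, (forall c : 'rV_N, (c <= M)%MS -> S c) /\
                                    \rank M = m >].
have exP : exists m, P m.
  exists 0%N; apply/asboolP; exists 0; split; last exact: mxrank0.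
  by move=> c; rewrite submx0 => /eqP ->; apply: vsub0.
have leP m : P m -> (m <= N)%N.
  by move=> /asboolP[M [_ <-]]; apply: rank_leq_col.
case: (ex_maxnP exP leP) => m /asboolP[M [MS rM]] maxm.
exists M => c; split=> [Sc|]; last exact: MS.
(* Adjoining [c] keeps the row space inside [S], so by maximality the rank does not grow and [c] was
   already in the row space. *)
have /maxm : P (\rank (M + c)%MS).
  apply/asboolP; exists (M + c)%MS; split=> // d /sub_addsmxP[[u w] /= ->].
  apply: vsubD => //; first by apply: MS; apply: submxMl.
  by rewrite [w]mx11_scalar mul_scalar_mx; apply: vsubZ.
rewrite -rM => h; have := mxrank_leqif_sup (addsmxSl M c).
move=> [h1 h2]; move: h2; rewrite eqn_leq h1 h => /esym.
exact: submx_trans (addsmxSr M c).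
Qed.


(** Turns a rank bound into polynomial equations. The minors range over all functions [f] and [g];
    the non-injective ones give determinants that vanish anyway. *)
Lemma rank_ltP (F : fieldType) (m n t : nat) (A : 'M[F]_(m, n)) :
  (\rank A < t)%N <->
  forall (f : 'I_t -> 'I_m) (g : 'I_t -> 'I_n), \det (mxsub f g A) = 0.
Proof.
split=> [rA f g|h].
  apply/eqP/negP=> /negP dN0; have : mxsub f g A \in unitmx.
    by rewrite unitmxE unitfE.
  move=> /mxrank_unit e; move: rA; rewrite ltnNge -{1}e => /negP; apply.
  have -> : mxsub f g A = rowsub f (rowsub g A^T)^T.
    by apply/matrixP=> i j; rewrite !mxE.
  apply: leq_trans (mxrankS (rowsub_sub _ _)) _.
  by rewrite mxrank_tr -[X in (_ <= X)%N]mxrank_tr mxrankS ?rowsub_sub.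
(* Otherwise [t] rows from a maximal free family, and then [t] independent columns of these, give an
   invertible minor. *)
rewrite ltnNge; apply/negP=> trA.
pose C' := rowsub (widen_ord trA) (rowsub (maxrankfun A) A).
have C'free : row_free C'.
  have /row_freeP[D hD] := maxrowsub_free A.
  apply/row_freeP; exists (colsub (widen_ord trA) D).
  apply/matrixP=> i j.
  move/matrixP: hD => /(_ (widen_ord trA i) (widen_ord trA j)).
  rewrite !mxE -val_eqE /= => <-.
  by apply: eq_bigr => k _; rewrite !mxE.
have frC : row_full C'^T by rewrite /row_full mxrank_tr.
have := fullrowsub_unit frC.
rewrite -unitmx_tr unitmxE unitfE => /negP; apply; apply/eqP.
rewrite -[RHS](h (fun i => maxrankfun A (widen_ord trA i)) (fullrankfun frC)).
by congr (\det _); apply/matrixP=> i j; rewrite !mxE.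
Qed.

Lemma linear_comb (F : fieldType) (V : lmodType F) (N m : nat)
    (phi : {linear 'rV[F]_N -> V}) (u : 'rV_m) (A : 'M[F]_(m, N)) :
  phi (u *m A) = \sum_i u 0 i *: phi (row i A).
Proof.
by rewrite mulmx_sum_row linear_sum; apply: eq_bigr => i _; rewrite linearZ.
Qed.

(** [phi] is injective modulo [E] and reaches every vector of [S] modulo [E] without leaving [S], so
    the quotient of [S] is the row space of [M]. *)
Lemma dim_ge_rank (F : fieldType) (V : lmodType F) (S E : set V) (N m : nat)
    (phi : {linear 'rV[F]_N -> V}) (M : 'M[F]_N) :
    vsubspace E -> (forall c, E (phi c) -> c = 0) ->
    (forall y, S y -> exists c, S (phi c) /\ E (y - phi c)) ->
    (forall c, S (phi c) <-> (c <= M)%MS) ->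
  dim_ge S E m <-> (m <= \rank M)%N.
Proof.
move=> hE phi_free phi_onto SM; split=> [[v [Sv v_free]]|mM].
  have [c hc] := choice (fun i => phi_onto _ (Sv i)).
  pose C := \matrix_i c i.
  have : row_free C.
    apply: inj_row_free => u uC; apply: v_free.
    have -> : \sum_i u 0 i *: v i = \sum_i u 0 i *: (v i - phi (c i)).
      under [RHS]eq_bigr do rewrite scalerBr.
      rewrite sumrB; suff -> : \sum_i u 0 i *: phi (c i) = 0 by rewrite subr0.
      transitivity (phi (u *m C)); last by rewrite uC linear0.
      rewrite linear_comb.
      by apply: eq_bigr => i _; rewrite rowK.
    by apply: vsub_sum => // i _; apply: vsubZ => //; have [] := hc i.
  move=> /eqP {1}<-; apply: mxrankS; apply/row_subP=> i; rewrite rowK.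
  by apply/SM; have [] := hc i.
exists (fun i => phi (row (widen_ord mM i) (row_base M))); split=> [i|c hc].
  by apply/SM; rewrite (submx_trans (row_sub _ _)) // eq_row_base.
have : c *m rowsub (widen_ord mM) (row_base M) = 0.
  apply: phi_free; rewrite linear_comb.
  by under eq_bigr do rewrite row_rowsub.
(* [d] is [c] extended by zero to all rows of the basis. *)
move=> c0; pose d : 'rV_(\rank M) := \row_j \sum_(i | widen_ord mM i == j) c 0 i.
have : d *m row_base M = 0.
  rewrite -c0 mulmx_sum_row [RHS]mulmx_sum_row.
  rewrite [RHS](partition_big (widen_ord mM) predT) //=.
  apply: eq_bigr => j _; rewrite mxE scaler_suml; apply: eq_bigr => i /eqP <-.
  by rewrite row_rowsub.
move=> dM; have d0 : d = 0.
  by apply: (row_free_inj (row_base_free M)); rewrite mul0mx dM.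
apply/rowP=> i; move/rowP: d0 => /(_ (widen_ord mM i)); rewrite !mxE.
by rewrite (big_pred1 i).
Qed.

(** In coordinates, a basis of [A] modulo [B] spans a complement [C] of [M'] in [M]. *)
Lemma quotient_dim_rank (F : fieldType) (V : lmodType F) (A B : set V)
    (N m : nat) (phi : {linear 'rV[F]_N -> V}) (M M' : 'M[F]_N) :
    vsubspace A -> vsubspace B -> B `<=` A ->
    (forall y, A y -> exists c, A (phi c) /\ B (y - phi c)) ->
    (forall c, A (phi c) <-> (c <= M)%MS) ->
    (forall c, B (phi c) <-> (c <= M')%MS) ->
  quotient_dim A B m -> \rank M = (\rank M' + m)%N.
Proof.
move=> hA hB BA phi_onto AM BM [v [Av hv]].
have [c hc] := choice (fun i => phi_onto _ (Av i)).
pose C := \matrix_i c i.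
have diff (u : 'rV_m) : B (\sum_i u 0 i *: v i - phi (u *m C)).
  have -> : \sum_i u 0 i *: v i - phi (u *m C)
      = \sum_i u 0 i *: (v i - phi (c i)).
    rewrite linear_comb -sumrB; apply: eq_bigr => i _.
    by rewrite rowK scalerBr.
  by apply: vsub_sum => // i _; apply: vsubZ => //; have [] := hc i.
have uC0 (u : 'rV_m) : (u *m C <= M')%MS -> u = 0.
  move=> /BM uC; have Bu : B (\sum_i u 0 i *: v i).
    rewrite -[X in B X](subrK (phi (u *m C))).
    by apply: vsubD uC => //.
  (* The vector lies in [B], so both [u] and [0] are coefficient rows for it; uniqueness identifies
     them. *)
  have [w [_ w_uniq]] := hv _ (BA _ Bu).
  have wu : w = u by apply: w_uniq; rewrite subrr; apply: vsub0.
  rewrite -wu; apply: w_uniq.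
  rewrite [X in _ - X]big1 => [|i _]; last by rewrite mxE scale0r.
  by rewrite subr0.
have Cfree : row_free C.
  by apply: inj_row_free => u uC; apply: uC0; rewrite uC sub0mx.
have CM' : (M' :&: C)%MS = 0.
  apply/eqP; rewrite -submx0; apply/rV_subP=> w; rewrite sub_capmx.
  move=> /andP[wM' /submxP[u wE]]; rewrite wE in wM' *.
  by rewrite (uC0 _ wM') mul0mx sub0mx.
have <- : \rank (M' + C)%MS = (\rank M' + m)%N.
  by rewrite (mxrank_disjoint_sum CM') (eqP Cfree).
apply/eqmx_rank/andP; split; last first.
  rewrite addsmx_sub; apply/andP; split.
    by apply/rV_subP=> w /BM /BA /AM.
  by apply/row_subP=> i; rewrite rowK; apply/AM; have [] := hc i.
apply/rV_subP=> w /AM Aw; have [u [hu _]] := hv _ Aw.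
rewrite -[w](subrK (u *m C)); apply: addmx_sub_adds; last exact: submxMl.
apply/BM; rewrite linearB /=.
have -> : phi w - phi (u *m C) = (phi w - \sum_i u 0 i *: v i)
    + (\sum_i u 0 i *: v i - phi (u *m C)) by rewrite addrA subrK.
by apply: vsubD.
Qed.

(** * Formal series and charts *)

(** V_(i, j) without the condition of finite support. It agrees with [Vcols] inside a bounded
    lattice, and it also makes sense for the infinite series in the fibers over s <> 0. *)
Definition Vset (R : realType) (n : nat) (i j : nat) : set (formal R n) :=
  [set f | forall (m : int) (a : 'I_n), ~~ (i <= a <= j)%N -> f m 0 a = 0].
Arguments Vset R {n} i j.

Lemma formalD (R : realType) (n : nat) (f g : formal R n) m :
  (f + g) m = f m + g m.
Proof. by []. Qed.

Lemma formalN (R : realType) (n : nat) (f : formal R n) m : (- f) m = - f m.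
Proof. by []. Qed.

Lemma formalZ (R : realType) (n : nat) (a : R[i]) (f : formal R n) m :
  (a *: f) m = a *: f m.
Proof. by []. Qed.

Lemma formal0 (R : realType) (n : nat) m : (0 : formal R n) m = 0.
Proof. by []. Qed.

Lemma formal_sum (R : realType) (n : nat) (I : Type) (r : seq I) (P : pred I)
    (f : I -> formal R n) m :
  (\sum_(i <- r | P i) f i) m = \sum_(i <- r | P i) f i m.
Proof. exact: (big_morph (fun g : formal R n => g m)). Qed.

Lemma formal_sumE (R : realType) (n : nat) (I : Type) (r : seq I) (P : pred I)
    (f : I -> formal R n) m a :
  (\sum_(i <- r | P i) f i) m 0 a = \sum_(i <- r | P i) f i m 0 a.
Proof. by rewrite formal_sum summxE. Qed.

Lemma Vset_vsub (R : realType) (n : nat) (i j : nat) :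
  vsubspace (Vset R (n := n) i j).
Proof.
split=> [m a _|c f g hf hg m a h]; first by rewrite formal0 mxE.
by rewrite formalD formalZ !mxE hf // hg // mulr0 addr0.
Qed.

Lemma tbasisE (R : realType) (n : nat) (j m : int) (i a : 'I_n) :
  tbasis R j i m 0 a = ((m == j) && (a == i))%:R.
Proof. by rewrite /tbasis; case: eqP; rewrite !mxE. Qed.

Lemma tbasis_expand (R : realType) (n K : nat) (f : formal R n) :
    (forall m : int, m < - K%:Z \/ K%:Z <= m -> f m = 0) ->
  f = \sum_(x : 'I_n * 'I_(2 * K))
        f (x.2%:Z - K%:Z) 0 x.1 *: tbasis R (x.2%:Z - K%:Z) x.1.
Proof.
move=> f0; apply/funext=> m; apply/rowP=> a; rewrite formal_sumE.
have [/orP mK|] := boolP ((m < - K%:Z) || (K%:Z <= m)).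
  rewrite f0 // mxE big1 // => -[i l] _; rewrite formalZ mxE tbasisE /=.
  case: eqP => [e|_]; last by rewrite mulr0.
  by have := ltn_ord l; move: mK e; case=> *; lia.
rewrite negb_or -!ltNge -leNgt => /andP[m1 m2].
have lt_l : (absz (m + K%:Z)%R < 2 * K)%N by lia.
rewrite (bigD1 (a, Ordinal lt_l)) //= big1 => [|[i l] /= ne].
  rewrite addr0 formalZ mxE tbasisE eqxx andbT.
  rewrite gez0_abs ?addrK ?eqxx ?mulr1 //.
  by lia.
rewrite formalZ mxE tbasisE; case: andP => [[/eqP e /eqP e']|_];
  last by rewrite mulr0.
case/negP: ne; rewrite -e' xpair_eqE eqxx /= -val_eqE /=; apply/eqP.
by lia.
Qed.

Lemma lspan_tbasisP (R : realType) (n : nat) (P : int -> 'I_n -> Prop)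
    (f : formal R n) :
  lspan [set f | exists j i, P j i /\ f = tbasis R j i] f <->
  (exists K : nat, forall m : int, m < - K%:Z \/ K%:Z <= m -> f m = 0) /\
  (forall (m : int) (a : 'I_n), ~ P m a -> f m 0 a = 0).
Proof.
split.
  move: f; apply: lspan_min => [|_ [j [i [Pji ->]]]].
    split=> [|a f g [[K hK] hf] [[K' hK'] hg]].
      split=> [|m a _]; first by exists 0%N.
      by rewrite formal0 mxE.
    split=> [|m b Pmb].
      exists (K + K')%N => m hm.
      rewrite formalD formalZ hK ?hK' ?scaler0 ?addr0 //.
        by case: hm => *; [left|right]; lia.
      by case: hm => *; [left|right]; lia.
    by rewrite formalD formalZ !mxE hf // hg // mulr0 addr0.
  split=> [|m a Pma].
    exists (`|j|.+1)%N => m hm; apply/rowP=> a; rewrite tbasisE mxE.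
    by case: eqP => // e; case: hm => *; lia.
  by rewrite tbasisE; case: andP => // -[/eqP e /eqP e']; rewrite e e' in Pma.
move=> [[K hK] hf]; rewrite (tbasis_expand hK).
apply: vsub_sum => [|x _]; first exact: lspan_vsub.
have [Px|/hf ->] := pselect (P (x.2%:Z - K%:Z) x.1).
  apply: (vsubZ _ (lspan_vsub _)).
  by apply: lspan_sub; exists (x.2%:Z - K%:Z), x.1.
by rewrite scale0r; apply: vsub0; apply: lspan_vsub.
Qed.

Lemma clattice_vsub (R : realType) (n : nat) (la : coweight n) :
  vsubspace (clattice R la).
Proof. exact: lspan_vsub. Qed.

Lemma clatticeP (R : realType) (n : nat) (la : coweight n) (f : formal R n) :
  clattice R la f <->
  (exists K : nat, forall m : int, K%:Z <= m -> f m = 0) /\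
  (forall (m : int) (a : 'I_n), m < - la a -> f m 0 a = 0).
Proof.
rewrite /clattice.
rewrite (@lspan_tbasisP R n (fun j i => is_true (- la i <= j)) f).
split=> -[[K hK] hf]; split.
- by exists K => m hm; apply: hK; right.
- by move=> m a hm; apply: hf; apply/negP; rewrite -ltNge.
- exists (K + \sum_a `|la a|)%N => m [hm|hm]; last by apply: hK; lia.
  apply/rowP=> a; rewrite mxE hf //.
  have : (`|la a| <= \sum_a `|la a|)%N by rewrite (bigD1 a) //= leq_addr.
  by lia.
- by move=> m a /negP; rewrite -ltNge => hm; apply: hf.
Qed.

Lemma tX0E (R : realType) (n : nat) (d : int) :
  tX0 R n d = clattice R [ffun _ : 'I_n => - d].
Proof.
apply/seteqP; split=> f.
  move=> [g /clatticeP[[K hK] hg] <-]; apply/clatticeP; split.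
    by exists (K + `|d|)%N => m hm; apply: hK; lia.
  move=> m a; rewrite ffunE opprK => hm; apply: hg; rewrite ffunE.
  by lia.
move=> /clatticeP[[K hK] hf]; exists (tpow (- d) f).
  apply/clatticeP; split.
    by exists (K + `|d|)%N => m hm; apply: hK; lia.
  by move=> m a; rewrite ffunE => hm; apply: hf; rewrite ffunE; lia.
by apply/funext=> m; rewrite /tpow opprK subrK.
Qed.

(** * Frames and chart coordinates *)

Definition comb (F : fieldType) (V : lmodType F) (I : finType) (b : I -> V)
    (c : 'rV[F]_#|I|) : V :=
  \sum_x c 0 (enum_rank x) *: b x.

Lemma comb_linear (F : fieldType) (V : lmodType F) (I : finType) (b : I -> V) :
  linear (comb b).
Proof.
move=> a c d; rewrite /comb scaler_sumr -big_split /=; apply: eq_bigr => x _.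
by rewrite !mxE scalerDl scalerA.
Qed.

HB.instance Definition _ (F : fieldType) (V : lmodType F) (I : finType)
    (b : I -> V) :=
  GRing.isLinear.Build F 'rV[F]_#|I| V *:%R (comb b) (comb_linear b).

(** Satisfied, with [E] the bottom subspace, by the frames of the charts of
    both [Gr_atlas] and [BD_atlas]. *)
Definition triangular (R : realType) (n K : nat) (d : int)
    (E : set (formal R n)) (b : 'I_n * 'I_K -> formal R n) : Prop :=
  [/\ forall (x : 'I_n * 'I_K) (m : int) (a : 'I_n), a != x.1 -> b x m 0 a = 0,
      forall (x : 'I_n * 'I_K) (m : int), x.2%:Z - d < m -> b x m = 0,
      forall x : 'I_n * 'I_K, b x (x.2%:Z - d) 0 x.1 = 1 &
      forall e (l : 'I_K) a, E e -> e (l%:Z - d) 0 a = 0].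

(** Back substitution from the largest [l]: at exponent [l - d] the frame vectors of smaller index
    vanish, and those of larger index already have coefficient zero. Columns do not interact, so the
    argument can be restricted to those in [C]. *)
Lemma triangular_eq0 (R : realType) (n K : nat) (d : int)
    (E : set (formal R n)) (b : 'I_n * 'I_K -> formal R n) (C : pred 'I_n)
    (c : 'rV_#|{: 'I_n * 'I_K}|) :
    triangular d E b ->
    (forall x : 'I_n * 'I_K, C x.1 -> comb b c (x.2%:Z - d) 0 x.1 = 0) ->
  forall x : 'I_n * 'I_K, C x.1 -> c 0 (enum_rank x) = 0.
Proof.
move=> [b_col b_top b_lead _] c0 [i l] /= Ci.
have [N] := ubnP (K - l); elim: N l => // N IH l lN.
have := c0 (i, l) Ci; rewrite formal_sumE (bigD1 (i, l)) //=.
rewrite formalZ mxE (b_lead (i, l)) mulr1 big1 ?addr0 //.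
move=> [i' l'] /= ne; rewrite formalZ mxE.
have [e|ne'] := eqVneq i i'; last by rewrite b_col ?mulr0.
subst i'.
have ne_l : (l' : nat) <> l by move=> /val_inj e; rewrite e eqxx in ne.
have [lt|le] := ltnP l' l.
  by rewrite b_top ?mxE ?mulr0 //=; lia.
by rewrite IH ?mul0r //; have := ltn_ord l'; lia.
Qed.

(** The generators of a chart subspace, written in the frame. The entries live in any ring, so that
    the chart variables themselves can be substituted. The inner sum has at most one term, and none
    when the column belongs to [J]. *)
Definition chart_mx (A : nzRingType) (I : finType) (J : {set I})
    (w : cells J -> A) : 'M[A]_(#|J|, #|I|) :=
  \matrix_(l, y) ((enum_val y == enum_val l)%:R +
    \sum_(z : cells J | val z == (enum_val l, enum_val y)) w z).

(** The columns indexed by [J] form an identity matrix. *)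
Lemma chart_mx_free (F : fieldType) (I : finType) (J : {set I})
    (v : cells J -> F) : row_free (chart_mx v).
Proof.
apply/row_freeP; exists (\matrix_(y, l) (enum_val y == enum_val l)%:R).
apply/matrixP=> l l'; rewrite !mxE (bigD1 (enum_rank (enum_val l'))) //=.
rewrite !mxE enum_rankK eqxx mulr1 big1 => [|z hz]; last first.
  by have := valP z; rewrite (eqP hz) /= (enum_valP l') andbF.
rewrite big1 => [|y ne]; first by rewrite !addr0 (inj_eq enum_val_inj) eq_sym.
rewrite !mxE; have [e|_] := eqVneq (enum_val y) (enum_val l').
  by case/eqP: ne; rewrite -e enum_valK.
by rewrite mulr0.
Qed.

Lemma comb_chart_row (F : fieldType) (V : lmodType F) (I : finType)
    (b : I -> V) (J : {set I}) (v : cells J -> F) (l : 'I_#|J|) :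
  comb b (row l (chart_mx v)) =
  b (enum_val l) + \sum_(z : cells J | (val z).1 == enum_val l)
                      v z *: b (val z).2.
Proof.
rewrite /comb; set x := enum_val l.
under eq_bigr do rewrite !mxE enum_rankK -/x scalerDl scaler_suml.
rewrite big_split /=; congr (_ + _).
  rewrite (bigD1 x) //= eqxx scale1r big1 ?addr0 // => y /negPf ->.
  by rewrite scale0r.
rewrite [RHS](partition_big (fun z : cells J => (val z).2) predT) //=.
apply: eq_bigr => y _; apply: eq_big => [z|z /eqP -> //].
by case: z => -[z1 z2] /= _; rewrite xpair_eqE.
Qed.

Lemma chart_space_vsub (F : fieldType) (V : lmodType F) (E : set V)
    (I : finType) (b : I -> V) (J : {set I}) (v : cells J -> F) :
  vsubspace E -> vsubspace (chart_space E b v).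
Proof. by move=> hE; apply: vsub_sumset => //; apply: lspan_vsub. Qed.

Lemma chart_space_sub (F : fieldType) (V : lmodType F) (E : set V)
    (I : finType) (b : I -> V) (J : {set I}) (v : cells J -> F) :
  vsubspace E -> E `<=` chart_space E b v.
Proof.
move=> hE e Ee; exists e => //; exists 0; last by rewrite addr0.
by apply: vsub0; apply: lspan_vsub.
Qed.

Lemma chart_spaceE (F : fieldType) (V : lmodType F) (E : set V)
    (I : finType) (b : I -> V) (J : {set I}) (v : cells J -> F) y :
  chart_space E b v y ->
  exists e, E e /\ exists u : 'rV_#|J|, y = e + comb b (u *m chart_mx v).
Proof.
move=> [e Ee [w hw <-]]; exists e; split=> //.
pose S : set V := [set w | exists u : 'rV_#|J|, w = comb b (u *m chart_mx v)].
suff [u ->] : S w by exists u.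
move: w hw; apply: lspan_min.
  split=> [|a _ _ [u ->] [u' ->]]; first by exists 0; rewrite mul0mx linear0.
  by exists (a *: u + u'); rewrite mulmxDl -scalemxAl linearP.
move=> _ [x xJ <-]; exists (delta_mx 0 (enum_rank_in xJ x)).
by rewrite -rowE comb_chart_row enum_rankK_in.
Qed.

Lemma chart_space_comb (F : fieldType) (V : lmodType F) (E : set V)
    (I : finType) (b : I -> V) (J : {set I}) (v : cells J -> F)
    (u : 'rV_#|J|) :
  vsubspace E -> chart_space E b v (comb b (u *m chart_mx v)).
Proof.
move=> hE; exists 0; first exact: vsub0.
exists (comb b (u *m chart_mx v)); last by rewrite add0r.
have hS := @lspan_vsub F V; rewrite linear_comb.
apply: (@vsub_sum F V (lspan _)) => [|l _]; first exact: hS.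
apply: (@vsubZ F V _ (u 0 l) (comb b (row l (chart_mx v))) (hS _)).
apply: lspan_sub; exists (enum_val l); last by rewrite comb_chart_row.
exact: enum_valP.
Qed.

(** The diagonal projector whose kernel consists of the combinations of the frame lying in
    [Vset R i j]. *)
Definition outside_mx (F : fieldType) (n K i j : nat) :
    'M[F]_#|{: 'I_n * 'I_K}| :=
  \matrix_(x < #|{: 'I_n * 'I_K}|, y < #|{: 'I_n * 'I_K}|)
    ((x == y) && ~~ (i <= (enum_val x).1 <= j)%N)%:R.

Lemma mul_outside_mx (F : fieldType) (n K i j : nat)
    (c : 'rV[F]_#|{: 'I_n * 'I_K}|) y :
  (c *m outside_mx F n K i j) 0 y =
  if (i <= (enum_val y).1 <= j)%N then 0 else c 0 y.
Proof.
rewrite mxE (bigD1 y) //= big1 ?addr0 => [|x /negPf ne]; last first.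
  by rewrite mxE ne mulr0.
by rewrite mxE eqxx /=; case: ifP; rewrite ?mulr0 ?mulr1.
Qed.

Lemma comb_Vset (R : realType) (n K : nat) (d : int) (E : set (formal R n))
    (b : 'I_n * 'I_K -> formal R n) (i j : nat) c :
  triangular d E b ->
  Vset R i j (comb b c) <-> c *m outside_mx R[i] n K i j = 0.
Proof.
move=> tri; have [b_col _ _ _] := tri; split=> [cV|/rowP c0].
  apply/rowP=> y; rewrite mul_outside_mx mxE; case: ifP => // /negbT yC.
  rewrite -[y]enum_valK.
  apply: (triangular_eq0 (C := fun a : 'I_n => ~~ (i <= a <= j)%N) tri) => //.
  by move=> x /cV.
move=> m a aC; rewrite formal_sumE big1 // => x _; rewrite formalZ mxE.
have [e|ne] := eqVneq a x.1; last by rewrite b_col ?mulr0.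
have := c0 (enum_rank x).
by rewrite mul_outside_mx enum_rankK -e (negPf aC) mxE => ->; rewrite mul0r.
Qed.

Lemma triangular_free (R : realType) (n K : nat) (d : int)
    (E : set (formal R n)) (b : 'I_n * 'I_K -> formal R n) c :
  triangular d E b -> E (comb b c) -> c = 0.
Proof.
move=> tri Ec; have [_ _ _ E0] := tri; apply/rowP=> y; rewrite mxE -[y]enum_valK.
by apply: (triangular_eq0 (C := predT) tri) => // x _; apply: E0.
Qed.

(** [e] has no coefficient at the exponents [l - d], and these alone determine the coordinates
    [c]. *)
Lemma triangular_Vset (R : realType) (n K : nat) (d : int)
    (E : set (formal R n)) (b : 'I_n * 'I_K -> formal R n) (i j : nat) e c :
  triangular d E b -> E e -> Vset R i j (e + comb b c) -> Vset R i j (comb b c).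
Proof.
move=> tri Ee ecV; apply/(comb_Vset _ _ _ tri); apply/rowP=> y.
have [_ _ _ E0] := tri; rewrite mul_outside_mx mxE; case: ifP => // /negbT yC.
rewrite -[y]enum_valK.
apply: (triangular_eq0 (C := fun a : 'I_n => ~~ (i <= a <= j)%N) tri) => //.
move=> x /(ecV (x.2%:Z - d) x.1); rewrite formalD mxE (E0 e) // add0r; exact.
Qed.

(** Rank-nullity: the chart subspace has dimension #|J| modulo [E], and cutting with V_(i, j) takes
    the kernel of [outside_mx]. *)
Lemma chart_dim_ge (R : realType) (n K : nat) (d : int) (E : set (formal R n))
    (b : 'I_n * 'I_K -> formal R n) (J : {set 'I_n * 'I_K})
    (v : cells J -> R[i]) (i j m : nat) :
    vsubspace E -> triangular d E b ->
  dim_ge (chart_space E b v `&` Vset R i j) E m <->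
  (m + \rank (chart_mx v *m outside_mx R[i] n K i j) <= #|J|)%N.
Proof.
move=> hE tri.
have hY := chart_space_vsub b v hE; have EY := chart_space_sub b v hE.
have rJ : \rank (chart_mx v) = #|J| by apply/eqP/chart_mx_free.
have dimE := @dim_ge_rank R[i] (formal R n) (chart_space E b v `&` Vset R i j) E
  _ m (comb b) (chart_mx v :&: kermx (outside_mx R[i] n K i j))%MS hE.
rewrite dimE {dimE}.
- have := mxrank_mul_ker (chart_mx v) (outside_mx R[i] n K i j).
  by rewrite rJ => e; rewrite -[X in _ <-> (_ <= X)%N]e addnC leq_add2l.
- by move=> c; apply: triangular_free tri.
- move=> y [/chart_spaceE[e [Ee [u yE]]] yV]; exists (u *m chart_mx v).
  split; last by rewrite yE addrK.
  split; last by apply: (triangular_Vset tri Ee); rewrite -yE.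
  exact: chart_space_comb.
move=> c; rewrite sub_capmx sub_kermx; split.
  move=> [/chart_spaceE[e [Ee [u cE]]] /(comb_Vset _ _ _ tri) ->].
  rewrite eqxx andbT; suff -> : c = u *m chart_mx v by apply: submxMl.
  apply/eqP; rewrite -subr_eq0; apply/eqP/(triangular_free tri).
  by rewrite linearB /= cE addrK.
move=> /andP[/submxP[u ->] /eqP c0]; split.
  exact: chart_space_comb.
by apply/(comb_Vset _ _ _ tri).
Qed.

(** * Relative dimensions of lattices *)

(** The dimension of [clattice R la] cut with V_(i, j), relative to that of X_0. *)
Definition wsum (n : nat) (la : coweight n) (i j : nat) : int :=
  \sum_(a < n | (i <= a <= j)%N) la a.

Definition cwdelta (n : nat) (a : 'I_n) : coweight n := [ffun j => (j == a)%:Z].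

Lemma wsum_delta (n : nat) (la : coweight n) (a : 'I_n) (i j : nat) :
  wsum (la + cwdelta a) i j = wsum la i j + (i <= a <= j)%N%:Z.
Proof.
rewrite /wsum; under eq_bigr do rewrite ffunE.
rewrite big_split /=; congr (_ + _); rewrite big_mkcond (bigD1 a) //= ffunE eqxx.
rewrite big1 => [|l /negPf ne]; first by rewrite addr0; case: ifP.
by rewrite ffunE ne; case: ifP.
Qed.

Lemma coweight_up_ind (n : nat) (P : coweight n -> Prop) (la mu : coweight n) :
    (forall la a, P la -> P (la + cwdelta a)) ->
    (forall a, la a <= mu a) ->
  P la -> P mu.
Proof.
move=> stepP; have [N] := ubnP (\sum_a `|mu a - la a|)%N.
elim: N la => // N IH la leN le_la Pla.
have [/forallP eq|/forallPn[a ne]] := boolP [forall a, la a == mu a].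
  by have <- : la = mu by apply/ffunP=> a; apply/eqP.
have lt_a : la a < mu a by rewrite lt_neqAle ne le_la.
have le_la' b : (la + cwdelta a) b <= mu b.
  rewrite !ffunE; case: eqVneq => [->|_]; last by rewrite addr0.
  by move: lt_a => /=; lia.
apply: (IH (la + cwdelta a)) => //; last exact: stepP.
rewrite ltnS in leN; apply: leq_trans leN.
rewrite [ltnRHS](bigD1 a) //= [ltnLHS](bigD1 a) //=.
rewrite -addSn leq_add //; first by rewrite !ffunE eqxx; move: lt_a => /=; lia.
apply: leq_sum => b /negPf nb; rewrite !ffunE nb addr0.
exact: leqnn.
Qed.

Lemma clattice_mono (R : realType) (n : nat) (la mu : coweight n) :
  (forall a, la a <= mu a) -> clattice R la `<=` clattice R mu.
Proof.
move=> le_la f /clatticeP[hK hf]; apply/clatticeP; split=> // m a hm.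
by apply: hf; have := le_la a; lia.
Qed.

Lemma clattice_delta_mono (R : realType) (n : nat) (la : coweight n) a :
  clattice R la `<=` clattice R (la + cwdelta a).
Proof. by apply: clattice_mono => b; rewrite !ffunE lerDl. Qed.

Lemma dim_ge_weaken (F : fieldType) (V : lmodType F) (S E E' : set V)
    (m : nat) :
    vsubspace S -> (forall y, S y -> E' y -> E y) ->
  dim_ge S E m -> dim_ge S E' m.
Proof.
move=> hS hE [v [Sv v_free]]; exists v; split=> // c hc; apply: v_free.
by apply: hE => //; apply: vsub_sum => // i _; apply: vsubZ.
Qed.

(** Independent of [la] when [clattice R la] is contained in [Y], see
    [rdim_ge_any]. *)
Definition rdim_ge (R : realType) (n : nat) (d : int) (i j : nat)
    (Y : set (formal R n)) (la : coweight n) : Prop :=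
  exists m : nat, d <= m%:Z + wsum la i j /\
    dim_ge (Y `&` Vset R i j) (clattice R la) m.

Section RelativeDimension.
Variables (R : realType) (n : nat) (d : int) (i j : nat).
Variable (Y : set (formal R n)).
Hypothesis (hY : vsubspace Y).

Let hS : vsubspace (Y `&` Vset R i j).
Proof. exact: vsubI hY (Vset_vsub _ _ _ _). Qed.

(** For a column [a] within [i..j], enlarging the reference costs at most one dimension in the
    quotient and gains exactly one in [wsum]; for other columns nothing changes inside V_(i, j). *)
Lemma rdim_ge_up la a : rdim_ge d i j Y la -> rdim_ge d i j Y (la + cwdelta a).
Proof.
move=> [m [dm Ym]]; rewrite /rdim_ge wsum_delta.
have [aij|aij] := boolP (i <= a <= j)%N; last first.
  exists m; split; first by rewrite addr0.
  apply: dim_ge_weaken Ym => // y [_ yV] /clatticeP[hK y0].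
  apply/clatticeP; split=> // l b hl.
  have [e|ne] := eqVneq b a; first by apply: yV; rewrite e.
  by apply: y0; rewrite !ffunE (negPf ne) addr0.
case: m => [|m] in dm Ym *.
  by exists 0%N; split; [move: dm => /=; lia|exact: dim_ge0].
exists m; split; first by move: dm => /=; lia.
(* t^(- la a - 1) e_a is the one basis vector by which the reference grows. *)
apply: (@dim_ge_contract _ _ _ (clattice R la) _
  (tbasis R (- la a - 1) a)) Ym => //.
- exact: clattice_vsub.
- exact: clattice_vsub.
move=> y [_ yV] /clatticeP[[K hK] y0]; exists (y (- la a - 1) 0 a).
apply/clatticeP; split.
  exists (K + `|la a|.+1)%N => l hl; apply/rowP=> b.
  rewrite formalD formalN formalZ hK; last by lia.
  rewrite !mxE tbasisE; case: eqP => [e|_]; last by rewrite mulr0 subr0.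
  by lia.
move=> l b hl; rewrite formalD formalN formalZ !mxE tbasisE.
have [eb|nb] := eqVneq b a; last first.
  rewrite andbF mulr0 subr0; apply: y0.
  by rewrite !ffunE (negPf nb) addr0.
rewrite andbT eb; have [->|nl] := eqVneq l (- la a - 1).
  by rewrite mulr1 subrr.
rewrite mulr0 subr0; apply: y0; rewrite !ffunE eqxx.
by move: hl nl; rewrite eb /= => hl /eqP nl; lia.
Qed.

(** The basis vector removed from the reference must lie in [Y] to compensate for the drop of
    [wsum], hence the inclusion. *)
Lemma rdim_ge_down la a :
    clattice R (la + cwdelta a) `<=` Y ->
  rdim_ge d i j Y (la + cwdelta a) -> rdim_ge d i j Y la.
Proof.
move=> laY [m []]; rewrite wsum_delta => dm Ym.
have [aij|aij] := boolP (i <= a <= j)%N; rewrite ?aij ?(negPf aij) in dm.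
  exists m.+1; split; first by move: dm => /=; lia.
  have bE : clattice R (la + cwdelta a) (tbasis R (- la a - 1) a).
    apply/clatticeP; split.
      exists (`|la a|.+1)%N => l hl; apply/rowP=> b; rewrite tbasisE mxE.
      by case: eqP => // e; lia.
    move=> l b hl; rewrite tbasisE; case: andP => // -[/eqP el /eqP eb].
    by move: hl; rewrite !ffunE eb eqxx el /=; lia.
  apply: dim_ge_extend Ym.
  - exact: clattice_vsub.
  - exact: clattice_delta_mono.
  - exact: bE.
  - split; first exact: laY.
    move=> l b hb; rewrite tbasisE; case: andP => // -[_ /eqP e].
    by rewrite e aij in hb.
  move=> c /clatticeP[_ /(_ (- la a - 1) a)]; rewrite formalZ mxE.
  by rewrite tbasisE !eqxx mulr1; apply; lia.
exists m; split; first by rewrite addr0 in dm.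
by apply: dim_ge_weaken Ym => // y _; apply: clattice_delta_mono.
Qed.

(** Descend from [la] to the minimum of [la] and [mu], where all references stay inside [Y], then
    ascend to [mu]. *)
Lemma rdim_ge_any la mu :
  clattice R la `<=` Y -> rdim_ge d i j Y la -> rdim_ge d i j Y mu.
Proof.
move=> laY Yla; pose nu : coweight n := [ffun a => Num.min (la a) (mu a)].
have Ynu : rdim_ge d i j Y nu.
  (* The descent is run as an upward induction from [nu], with the inclusion in [Y] carried inside
     [P]. *)
  move: laY Yla; pose P mu' := clattice R mu' `<=` Y ->
     rdim_ge d i j Y mu' -> rdim_ge d i j Y nu.
  apply: (@coweight_up_ind n P nu la) => [la' a IH laY /rdim_ge_down Yla|a|//].
    apply: IH; last exact: Yla.
    by move=> y /clattice_delta_mono /laY.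
  by rewrite ffunE ge_min lexx.
apply: (@coweight_up_ind n (rdim_ge d i j Y) nu mu) => // [la' a|a].
  exact: rdim_ge_up.
by rewrite ffunE ge_min lexx orbT.
Qed.

End RelativeDimension.

(** * Semicontinuity on the affine Grassmannian *)

Lemma peval_pvar (F : fieldType) (K : finType) (v : K -> F) (x : K) :
  peval v (pvar F x) = v x.
Proof. by rewrite /peval /pvar mpoly.mevalXU enum_rankK. Qed.

(** [w] places the cells among the variables of the chart: it is [id] for [Gr_atlas] and [Some] for
    [BD_atlas], where [None] is the coordinate s. *)
Lemma chart_rank_closed (F : fieldType) (n K : nat) (J : {set 'I_n * 'I_K})
    (X : finType) (w : cells J -> X) (i j : nat) (t : int) :
  exists E : set (polys F X), forall v : X -> F,
    (\rank (chart_mx (fun z => v (w z)) *m outside_mx F n K i j))%:Z < t <->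
    forall f, E f -> peval v f = 0.
Proof.
(* For t <= 0 the condition is empty, cut out by the equation 1 = 0. *)
have [t0|t0] := ltP 0 t; last first.
  exists [set f : polys F X | f = 1] => v; split=> [h|/(_ 1 erefl)]; first by lia.
  by rewrite /peval rmorph1 => /eqP; rewrite oner_eq0.
pose A := chart_mx (fun z => pvar F (w z)) *m
  map_mx (fun c => mpoly.mpolyC _ c) (outside_mx F n K i j).
exists [set f | exists (g : 'I_`|t|%N -> 'I_#|J|) h, f = \det (mxsub g h A)] => v.
have AE : chart_mx (fun z => v (w z)) *m outside_mx F n K i j = map_mx (peval v) A.
  rewrite /A /peval map_mxM; congr (_ *m _); apply/matrixP=> x y.
    rewrite !mxE rmorphD rmorph_nat rmorph_sum; congr (_ + _).
    by apply: eq_bigr => z _; rewrite -[RHS]/(peval v _) peval_pvar.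
  by rewrite !mxE /= mpoly.mevalC.
rewrite AE; have -> : ((\rank (map_mx (peval v) A))%:Z < t) =
    (\rank (map_mx (peval v) A) < `|t|)%N by lia.
have detE g h :
  peval v (\det (mxsub g h A)) = \det (mxsub g h (map_mx (peval v) A)).
  by rewrite /peval -det_map_mx map_mxsub.
rewrite rank_ltP; split=> [h _ [f [g ->]]|h f g]; first by rewrite detE.
by rewrite -detE; apply: h; exists f, g.
Qed.

Lemma Gr_frame_triangular (R : realType) (n k : nat) :
  triangular k%:Z (tX0 R n k%:Z)
    (fun x : 'I_n * 'I_(2 * k) => tbasis R (x.2%:Z - k%:Z) x.1).
Proof.
split=> [x m a|x m|x|e l a].
- by rewrite tbasisE => /negPf ->; rewrite andbF.
- by move=> hm; apply/rowP=> a; rewrite tbasisE mxE; case: eqP => // e; lia.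
- by rewrite tbasisE !eqxx.
by rewrite tX0E => /clatticeP[_]; apply; rewrite ffunE; have := ltn_ord l; lia.
Qed.

Lemma rdim_ge_closed (R : realType) (n : nat) (d : int) (i j : nat) :
  zclosed (Gr_atlas R n) [set Y | forall la, rdim_ge d i j Y la].
Proof.
move=> [k J] /=.
pose la : coweight n := [ffun _ => - k%:Z].
(* This is [d <= (#|J| - rank) + wsum la i j], solved for the rank as a strict inequality. *)
have [E hE] := @chart_rank_closed R[i] n _ J _ id i j
  (#|J|%:Z + 1 + wsum la i j - d).
exists E => v; rewrite -hE {E hE}.
rewrite (_ : chart_mx (fun z => v (id z)) = chart_mx v) //.
have hX0 : vsubspace (tX0 R n k%:Z) by rewrite tX0E; apply: clattice_vsub.
have tri := @Gr_frame_triangular R n k.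
set Y := chart_space _ _ _; split=> [/(_ la)[m []]|lt_r la'].
  rewrite -tX0E => dm /(chart_dim_ge _ _ _ _ hX0 tri) mr.
  have aux (w : int) (m0 r c : nat) :
    d <= m0%:Z + w -> (m0 + r <= c)%N -> r%:Z < c%:Z + 1 + w - d by lia.
  exact: aux dm mr.
apply: (@rdim_ge_any R n d i j Y _ la); first exact: chart_space_vsub.
  by rewrite -tX0E; apply: chart_space_sub.
have aux (w : int) (r c : nat) : (r <= c)%N -> r%:Z < c%:Z + 1 + w - d ->
  d <= (c - r)%N%:Z + w by lia.
have rJ := rank_leq_row (chart_mx v *m outside_mx R[i] n (2 * k) i j).
exists (#|J| - \rank (chart_mx v *m outside_mx R[i] n (2 * k) i j))%N.
split; first exact: aux rJ lt_r.
by rewrite -tX0E; apply/(chart_dim_ge _ _ _ _ hX0 tri); rewrite subnK.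
Qed.

(** * Weakly compatible lattices *)

Definition generic_dim (n : nat) (p : ekpicture n) (i j : nat) : int :=
  wsum p.2 i j +
  \sum_(A : loop n | (i <= lend A)%N && (rend A <= j)%N) (p.1 A)%:Z.

Lemma wsum_rec (n : nat) (la : coweight n) (i j : nat) :
  (i < j)%N ->
  wsum la i j = wsum la i.+1 j + wsum la i j.-1 - wsum la i.+1 j.-1.
Proof.
move=> ij; rewrite /wsum; apply/eqP; rewrite eq_sym subr_eq; apply/eqP.
rewrite [in LHS]big_mkcond [X in _ + X = _]big_mkcond [in RHS]big_mkcond.
rewrite [X in _ = _ + X]big_mkcond -!big_split /=; apply: eq_bigr => a _.
have [h1|h1] := boolP (i.+1 <= a <= j)%N; have [h2|h2] := boolP (i <= a <= j.-1)%N;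
  have [h3|h3] := boolP (i <= a <= j)%N;
  have [h4|h4] := boolP (i.+1 <= a <= j.-1)%N; rewrite ?addr0 ?add0r //; lia.
Qed.

(** Among the loops within the ends of [A], only [A] itself fits into neither of the two intervals
    obtained by dropping an end column. *)
Lemma generic_dim_rec (n : nat) (p : ekpicture n) (A : loop n) :
  generic_dim p (lend A) (rend A) =
  generic_dim p (lend A).+1 (rend A) + generic_dim p (lend A) (rend A).-1
    - generic_dim p (lend A).+1 (rend A).-1 + (p.1 A)%:Z.
Proof.
have ij : (lend A < rend A)%N := valP A.
rewrite /generic_dim (wsum_rec _ ij).
set s := fun i j => \sum_(B : loop n | (i <= lend B)%N && (rend B <= j)%N)
  (p.1 B)%:Z.
suff sE : s (lend A) (rend A) + s (lend A).+1 (rend A).-1 =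
    s (lend A).+1 (rend A) + s (lend A) (rend A).-1 + (p.1 A)%:Z.
  by move: sE; rewrite /s; lia.
have -> : (p.1 A)%:Z = \sum_(B : loop n | B == A) (p.1 B)%:Z.
  by rewrite big_pred1_eq.
rewrite /s [in LHS]big_mkcond [X in _ + X = _]big_mkcond.
rewrite [X in _ = X + _ + _]big_mkcond [X in _ = _ + X + _]big_mkcond.
rewrite [X in _ = _ + _ + X]big_mkcond -!big_split /=; apply: eq_bigr => B _.
have BA : (B == A) = ((lend B : nat) == lend A) && ((rend B : nat) == rend A).
  apply/eqP/andP => [->|[/eqP e1 /eqP e2]]; first by rewrite !eqxx.
  apply/val_inj; rewrite [LHS]surjective_pairing [RHS]surjective_pairing.
  by congr pair; apply/val_inj.
have := valP B; rewrite BA -/(lend B) -/(rend B); move: ij => /=.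
do 5 case: ifP => ?; lia.
Qed.

Section WeaklyCompatible.
Variables (R : realType) (n : nat) (p : ekpicture n) (Y : set (formal R n)).
Hypotheses (YGr : is_lattice Y) (pY : weakly_compatible p Y).

Let hY : vsubspace Y. Proof. by case: YGr. Qed.

Lemma lattice_shift (d : nat) y : Y y -> Y (tpow d%:Z y).
Proof.
move=> Yy; elim: d => [|d IH].
  by have -> : tpow 0%:Z y = y by apply/funext=> m; rewrite /tpow subr0.
have [_ tY _] := YGr; apply: tY; exists (tpow d%:Z y) => //.
by apply/funext=> m; rewrite /tpow; congr (y _); lia.
Qed.

Lemma tX0_tbasis (k : nat) (j : int) (a : 'I_n) :
  k%:Z <= j -> tX0 R n k%:Z (tbasis R j a).
Proof.
move=> kj; rewrite tX0E; apply/clatticeP; split.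
  exists (`|j|.+1)%N => m hm; apply/rowP=> b; rewrite tbasisE mxE.
  by case: eqP => // e; lia.
move=> m b; rewrite ffunE tbasisE; case: eqP => // -> hm; lia.
Qed.

(** Modulo t^k X_0, which lies in [Y], the vector is a finite combination of t^l e_a with l >= j.
    Its shifts start at higher exponents, so by induction [Y] contains the terms with l > j;
    subtracting them leaves a nonzero multiple of t^j e_a. *)
Lemma lattice_lowest_term (a : 'I_n) y (j : int) :
    Y y -> (forall m b, b != a -> y m 0 b = 0) ->
    (forall m, m < j -> y m = 0) -> y j 0 a != 0 ->
  Y (tbasis R j a).
Proof.
have [_ _ [k [kY Yk]]] := YGr.
have [N] := ubnP (absz (Num.max 0 (k%:Z - j))).
elim: N y j => // N IH y j jN Yy ya y0 yj.
have [kj|jk] := leP k%:Z j; first by apply/kY/tX0_tbasis.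
have /Yk := Yy; rewrite tX0E => /clatticeP[[B hB] _].
pose f : formal R n := fun m => if m < k%:Z then y m else 0.
have Yf : Y f.
  have -> : f = y - (y - f) by rewrite opprB addrC subrK.
  apply: vsubB => //; apply: kY; rewrite tX0E; apply/clatticeP; split.
    exists (B + k)%N => m hm; rewrite formalD formalN /f hB; last by lia.
    by case: ifP => //; rewrite ?subrr ?subr0.
  move=> m b; rewrite ffunE opprK => hm.
  by rewrite formalD formalN /f hm subrr mxE.
have f0 m : m < j -> f m = 0 by move=> hm; rewrite /f y0 // if_same.
have fk m : k%:Z <= m -> f m = 0 by rewrite /f leNgt => /negPf ->.
have fa m b : b != a -> f m 0 b = 0.
  by move=> h; rewrite /f; case: ifP; rewrite ?mxE ?ya.
have fj : f j 0 a != 0 by rewrite /f jk.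
have fE : f = \sum_(l < absz (k%:Z - j)) f (j + l%:Z) 0 a *: tbasis R (j + l%:Z) a.
  apply/funext=> m; apply/rowP=> b; rewrite formal_sumE.
  have [->|nb] := eqVneq b a; last first.
    rewrite fa // big1 // => l _; rewrite formalZ mxE tbasisE (negPf nb) andbF.
    by rewrite mulr0.
  have [mj|jm] := ltP m j.
    rewrite f0 // mxE big1 // => l _; rewrite formalZ mxE tbasisE.
    by case: eqP => [e|_]; [lia|rewrite mulr0].
  have [mk|km] := ltP m k%:Z; last first.
    rewrite fk // mxE big1 // => l _; rewrite formalZ mxE tbasisE.
    by case: eqP => [e|_]; [have := ltn_ord l; lia|rewrite mulr0].
  have lt_l : (absz (m - j)%R < absz (k%:Z - j)%R)%N by lia.
  rewrite (bigD1 (Ordinal lt_l)) //= big1 => [|l ne].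
    rewrite addr0 formalZ mxE tbasisE eqxx andbT gez0_abs; last by lia.
    by rewrite addrC subrK eqxx mulr1.
  rewrite formalZ mxE tbasisE; case: eqP => [e|_]; last by rewrite mulr0.
  have e2 : m - j = l%:Z by rewrite e [j + _]addrC addrK.
  by case/negP: ne; apply/eqP/val_inj; rewrite /= e2.
have lt0 : (0 < absz (k%:Z - j)%R)%N by lia.
have hsum : Y (\sum_(l < absz (k%:Z - j) | l != Ordinal lt0)
                  f (j + l%:Z) 0 a *: tbasis R (j + l%:Z) a).
  apply: vsub_sum => // l ne; apply: vsubZ => //.
  (* The shift by t^l has its lowest term at [j + l], closer to the bound [k]. *)
  apply: (IH (tpow l%:Z f)).
  - have : (0 < l)%N by rewrite lt0n; apply: contraNneq ne => e; apply/eqP/val_inj.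
    by move: jN; rewrite !maxEge; do 2 case: ifP; lia.
  - exact: lattice_shift.
  - by move=> m b nb; apply: fa.
  - by move=> m hm; apply: f0; lia.
  by rewrite /tpow addrK.
have : Y (f j 0 a *: tbasis R j a).
  have := vsubB hY Yf hsum.
  by rewrite {1}fE (bigD1 (Ordinal lt0)) //= addr0 addrK.
move=> /(vsubZ (f j 0 a)^-1 hY); rewrite scalerA mulVf // scale1r; exact.
Qed.

Lemma clattice_weakly_compatible : clattice R p.2 `<=` Y.
Proof.
have [_ ->] := pY; apply: lspan_min => // f [//].
Qed.

(** If [y] had a term below the exponents allowed by eta, its lowest term would give a basis vector
    of [Y] outside the lattice of eta, which is the span of all basis vectors in [Y]. *)
Lemma weakly_compatible_column (a : 'I_n) y :
  Y y -> Vset R a a y -> clattice R p.2 y.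
Proof.
move=> Yy yV; have [_ _ [k [kY Yk]]] := YGr.
have /Yk := Yy; rewrite tX0E => /clatticeP[hB ylow].
have ya m b : b != a -> y m 0 b = 0.
  move=> nb; apply: yV; apply: contra nb => h.
  by apply/eqP/val_inj/eqP; rewrite eqn_leq andbC.
apply/clatticeP; split=> // m b hm.
have [eb|nb] := eqVneq b a; last exact: ya.
rewrite eb in hm *; apply/eqP/negPn/negP=> ym.
have [N mN] : exists N : nat, m + k%:Z < N%:Z.
  by exists (absz (m + k%:Z)%R).+1; lia.
elim: N m hm ym mN => [|N IH] m hm ym mN.
  by case/eqP: ym; apply: ylow; rewrite ffunE; lia.
(* Descend to the lowest nonzero term; this stops because [y] lies in t^(-k) X_0. *)
have [[l [lm yl]]|hlow] := pselect (exists l, l < m /\ y l 0 a != 0).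
  by apply: (IH l) => //; lia.
have : clattice R p.2 (tbasis R m a).
  have [_ ->] := pY; apply: lspan_sub; split.
    apply: (lattice_lowest_term Yy ya _ ym) => l lm; apply/rowP=> c; rewrite mxE.
    have [->|nc] := eqVneq c a; last exact: ya.
    by apply/eqP/negPn/negP=> yl; apply: hlow; exists l.
  by exists m => //; exists a.
move=> /clatticeP[_ /(_ m a hm)] /eqP.
by rewrite tbasisE !eqxx oner_eq0.
Qed.

End WeaklyCompatible.

Lemma dim_ge_sub0 (F : fieldType) (V : lmodType F) (S E : set V) (m : nat) :
  vsubspace E -> S `<=` E -> dim_ge S E m -> m = 0%N.
Proof.
move=> hE SE [v [Sv v_free]]; case: m v Sv v_free => // m v Sv v_free.
have /rowP/(_ 0) : const_mx 1 = 0 :> 'rV[F]_m.+1.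
  by apply: v_free; apply: vsub_sum => // i _; apply: vsubZ => //; apply/SE/Sv.
by rewrite !mxE => /eqP; rewrite oner_eq0.
Qed.

Lemma wsum_gt (n : nat) (la : coweight n) (i j : nat) :
  (j < i)%N -> wsum la i j = 0.
Proof. by move=> ji; rewrite /wsum big_pred0 // => a; lia. Qed.

Lemma wsum1 (n : nat) (la : coweight n) (a : 'I_n) : wsum la a a = la a.
Proof.
rewrite /wsum (big_pred1 a) // => b.
apply/idP/eqP => [h|->]; last by rewrite leqnn.
by apply/val_inj/eqP; rewrite eqn_leq andbC.
Qed.

Lemma generic_dim_ge (n : nat) (p : ekpicture n) (i j : nat) :
  (j <= i)%N -> generic_dim p i j = wsum p.2 i j.
Proof.
move=> ji; rewrite /generic_dim big_pred0 ?addr0 // => A.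
apply/negP=> /andP[h1 h2].
have : (lend A < rend A)%N := valP A.
by lia.
Qed.

(** Coordinate lattices split by columns: column [i] goes to one summand, the others to the second.
    The reference lattice thus disappears in the quotients that define weak compatibility. *)
Lemma Vset_cat (R : realType) (n i j : nat) (E : set (formal R n))
    (la : coweight n) :
  (i < j)%N -> E = clattice R la ->
  E `&` Vset R i j `<=`
    sumset (E `&` Vset R i.+1 j) (E `&` Vset R i j.-1).
Proof.
move=> ij -> f [fE fV]; have /clatticeP[[K hK] flow] := fE.
pose g : formal R n := fun m => \row_a (if (a == i :> nat) then f m 0 a else 0).
have gE : clattice R la g.
  apply/clatticeP; split=> [|m a hm].
    by exists K => m hm; apply/rowP=> a; rewrite !mxE hK // mxE if_same.
  by rewrite mxE flow // if_same.
exists (f - g); last first.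
  exists g; last by rewrite subrK.
  split=> // m a aij; rewrite mxE; case: eqP => // ai; apply: fV.
  by apply: contra aij => _; lia.
split; first exact: vsubB (clattice_vsub _ _) fE gE.
move=> m a aij; rewrite formalD formalN !mxE; case: eqP => [|ai].
  by rewrite subrr.
by rewrite subr0 fV //; apply: contra aij => ?; lia.
Qed.

Lemma Vcols_bounded (R : realType) (n i j k : nat) (Y : set (formal R n)) :
  Y `<=` tX0 R n (- k%:Z) -> Y `&` Vcols R i j = Y `&` Vset R i j.
Proof.
move=> Yk; apply/seteqP; split=> y [Yy yV]; split=> //.
  move: yV; rewrite /Vcols.
  rewrite (@lspan_tbasisP R n (fun _ a => is_true (i <= a <= j)%N) y) => -[_ yV].
  by move=> m a /negP; apply: yV.
rewrite /Vcols (@lspan_tbasisP R n (fun _ a => is_true (i <= a <= j)%N) y).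
have /Yk := Yy; rewrite tX0E => /clatticeP[[K hK] ylow]; split.
  exists (K + k)%N => m [hm|hm]; last by apply: hK; lia.
  by apply/rowP=> a; rewrite mxE ylow // ffunE; lia.
by move=> m a /negP; apply: yV.
Qed.

Lemma tX0_truncate (R : realType) (n k : nat) (y : formal R n) :
    tX0 R n (- k%:Z) y ->
  exists c, let z :=
    comb (fun x : 'I_n * 'I_(2 * k) => tbasis R (x.2%:Z - k%:Z) x.1) c in
  tX0 R n k%:Z (y - z) /\ forall i j, Vset R i j y -> Vset R i j z.
Proof.
rewrite !tX0E => /clatticeP[[B hB] ylow].
exists (\row_l y ((enum_val l : 'I_n * 'I_(2 * k)).2%:Z - k%:Z) 0 (enum_val l).1).
set z := comb _ _; move=> /=.
pose f : formal R n := fun m => if m < k%:Z then y m else 0.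
have zE : z = f.
  rewrite (@tbasis_expand R n k f); last first.
    move=> m [hm|hm]; rewrite /f; last by rewrite ltNge hm.
    case: ifP => // _; apply/rowP=> a; rewrite mxE ylow // ffunE.
    by lia.
  apply: eq_bigr => x _; rewrite mxE enum_rankK /f ifT //.
  by rewrite ltrBlDr -PoszD ltz_nat addnn -mul2n.
rewrite zE; split=> [|i j yV m a aij]; last first.
  by rewrite /f; case: ifP => _; rewrite ?mxE // yV.
apply/clatticeP; split.
  exists (B + k)%N => m hm; rewrite formalD formalN /f hB; last by lia.
  by case: ifP; rewrite subr0.
move=> m b; rewrite ffunE opprK => hm.
by rewrite formalD formalN /f hm subrr mxE.
Qed.

(** The ranks of the spaces Y cap V_(i, j) obey the recursion of [generic_dim]: the quotient by the
    sum of the two smaller spaces has dimension [p.1 A], and those two meet in the space of the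
    inner interval. In the upper bound the reference must lie in [Y], so that [m] measures all of
    the difference. *)
Lemma weakly_compatible_dim (R : realType) (n : nat) (p : ekpicture n)
    (Y : set (formal R n)) (i j : nat) (la : coweight n) :
    is_lattice Y -> weakly_compatible p Y -> (j < n)%N ->
  rdim_ge (generic_dim p i j) i j Y la /\
  (forall m, clattice R la `<=` Y ->
     dim_ge (Y `&` Vset R i j) (clattice R la) m ->
     m%:Z + wsum la i j <= generic_dim p i j).
Proof.
move=> YGr pY; have [hY _ [k [kY Yk]]] := YGr.
pose lak : coweight n := [ffun _ => - k%:Z].
have EE : tX0 R n k%:Z = clattice R lak by rewrite tX0E.
have hE : vsubspace (tX0 R n k%:Z) by rewrite EE; apply: clattice_vsub.
have tri := @Gr_frame_triangular R n k.
set E := tX0 R n k%:Z in kY EE hE tri *.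
set b := fun x : 'I_n * 'I_(2 * k) => _ in tri.
have hS i' j' : vsubspace (Y `&` Vset R i' j').
  exact: vsubI hY (Vset_vsub _ _ _ _).
have onto i' j' y : (Y `&` Vset R i' j') y ->
    exists c, (Y `&` Vset R i' j') (comb b c) /\
              (E `&` Vset R i' j') (y - comb b c).
  move=> [Yy yV]; have [c [hz /(_ _ _ yV) zV]] := tX0_truncate (Yk _ Yy).
  exists c; split; last by split=> //; apply: (vsubB (Vset_vsub _ _ _ _)).
  split=> //; have -> : comb b c = y - (y - comb b c) by rewrite opprB addrC subrK.
  by apply: vsubB => //; apply: kY.
have exM (ij : nat * nat) : exists M : 'M[R[i]]_#|{: 'I_n * 'I_(2 * k)}|,
    forall c, (Y `&` Vset R ij.1 ij.2) (comb b c) <-> (c <= M)%MS.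
  apply: (@subspace_matrix _ _ [set c | (Y `&` Vset R ij.1 ij.2) (comb b c)]).
  split=> /= [|a u v hu hv]; first by rewrite linear0; exact: (vsub0 (hS _ _)).
  by rewrite linearP; apply: (proj2 (hS _ _)).
have [M' hM'] := choice exM; pose M i j := M' (i, j).
have hM i' j' c : (Y `&` Vset R i' j') (comb b c) <-> (c <= M i' j')%MS.
  exact: (hM' (i', j')).
have rankM i' j' m : dim_ge (Y `&` Vset R i' j') (clattice R lak) m <->
    (m <= \rank (M i' j'))%N.
  rewrite -EE; apply: (@dim_ge_rank _ _ _ _ _ _ (comb b)) => //.
    by move=> c; apply: triangular_free tri.
    by move=> y /onto[c [cY [cE _]]]; exists c.
  exact: hM.
(* It suffices to treat the reference t^k X_0; [rdim_ge_any] carries both inequalities to [la]. *)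
suff main : forall i' j', (j' < n)%N ->
    (\rank (M i' j'))%:Z + wsum lak i' j' = generic_dim p i' j'.
  move=> jn; have lakY : clattice R lak `<=` Y by rewrite -EE.
  split=> [|m laY Ym].
    apply: (@rdim_ge_any R n _ i j Y hY lak) => //.
    by exists (\rank (M i j)); split; [rewrite main|apply/rankM].
  have : rdim_ge (m%:Z + wsum la i j) i j Y lak.
    by apply: (@rdim_ge_any R n _ i j Y hY la) => //; exists m.
  by move=> [m' [mm' /rankM m'r]]; rewrite -main //; lia.
move=> i' j'; have [N] := ubnP (j' - i'); elim: N i' j' => // N IH i' j' jN jn.
have [ji|ij|ij] := ltngtP j' i'.
- rewrite generic_dim_ge 1?ltnW // !wsum_gt // addr0.
  suff -> : M i' j' = 0 by rewrite mxrank0.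
  apply/eqP; rewrite -submx0; apply/rV_subP=> c /hM[_ cV]; rewrite submx0.
  apply/eqP/(triangular_free tri); suff -> : comb b c = 0 by apply: vsub0.
  apply/funext=> m; apply/rowP=> a; rewrite formal0 mxE cV //.
  by lia.
- pose A : loop n := exist _ (Ordinal (ltn_trans ij jn), Ordinal jn) ij.
  have quo : quotient_dim (Y `&` Vset R i' j')
      (sumset (Y `&` Vset R i'.+1 j') (Y `&` Vset R i' j'.-1)) (p.1 A).
    have [/(_ A)] := pY.
    by rewrite !(Vcols_bounded _ _ Yk).
  have BA : sumset (Y `&` Vset R i'.+1 j') (Y `&` Vset R i' j'.-1)
      `<=` Y `&` Vset R i' j'.
    move=> _ [u [Yu uV] [v [Yv vV] <-]]; split; first exact: vsubD.
    move=> m a aij; rewrite formalD mxE uV ?vV ?addr0 //.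
      by apply: contra aij => ?; lia.
    by apply: contra aij => ?; lia.
  have rE : \rank (M i' j') = (\rank (M i'.+1 j' + M i' j'.-1)%MS + p.1 A)%N.
    apply: (@quotient_dim_rank _ _ _ _ _ _ (comb b) _ _ _ _ BA) quo => //.
    + exact: vsub_sumset.
    (* The error of the coordinates lies in the reference lattice, which splits by columns and hence
       falls into the sum of the two smaller spaces. *)
    + move=> y /onto[c [cY /(Vset_cat ij EE)[u [uE uV] [v [vE vV] uv]]]].
      exists c; split=> //; exists u; first by split=> //; apply: kY.
      by exists v => //; split=> //; apply: kY.
    + exact: hM.
    move=> c; split; last first.
      move=> /sub_addsmxP[[u v] /= ->]; exists (comb b (u *m M i'.+1 j')).
        by apply/hM; apply: submxMl.
      exists (comb b (v *m M i' j'.-1)); last by rewrite linearD.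
      by apply/hM; apply: submxMl.
    move=> [u /onto[cu [/hM cuM [uE _]]] [v /onto[cv [/hM cvM [vE _]]] uvc]].
    suff -> : c = cu + cv by apply: addmx_sub_adds.
    apply/eqP; rewrite -subr_eq0; apply/eqP/(triangular_free tri).
    have -> : comb b (c - (cu + cv)) = (u - comb b cu) + (v - comb b cv).
      by rewrite linearB linearD /= -uvc opprD addrACA.
    exact: vsubD.
  have capE : \rank (M i'.+1 j' :&: M i' j'.-1)%MS = \rank (M i'.+1 j'.-1).
    apply/eqmx_rank/andP; split; apply/rV_subP=> c.
      rewrite sub_capmx => /andP[/hM[Yc c1] /hM[_ c2]]; apply/hM; split=> //.
      move=> m a aij; have [ai|ai] := ltnP i' a; last by apply: c1; lia.
      by apply: c2; apply: contra aij => ?; lia.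
    move=> /hM[Yc cV]; rewrite sub_capmx; apply/andP; split; apply/hM; split=> //.
      by move=> m a aij; apply: cV; apply: contra aij => ?; lia.
    by move=> m a aij; apply: cV; apply: contra aij => ?; lia.
  have := mxrank_sum_cap (M i'.+1 j') (M i' j'.-1); rewrite capE => sumE.
  have h1 : (\rank (M i'.+1 j'))%:Z + _ = _ :=
    IH i'.+1 j' ltac:(lia) ltac:(lia).
  have h2 : (\rank (M i' j'.-1))%:Z + _ = _ :=
    IH i' j'.-1 ltac:(lia) ltac:(lia).
  have h3 : (\rank (M i'.+1 j'.-1))%:Z + _ = _ :=
    IH i'.+1 j'.-1 ltac:(lia) ltac:(lia).
  rewrite (@generic_dim_rec n p A) /= -h1 -h2 -h3 (wsum_rec _ ij) rE PoszD.
  have aux (a0 b0 c0 d0 x0 : nat) (u v w : int) : (a0 + b0 = c0 + d0)%N ->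
    a0%:Z + x0%:Z + (u + v - w) = c0%:Z + u + (d0%:Z + v) - (b0%:Z + w) + x0%:Z.
    by lia.
  exact: aux sumE.
subst j'; pose a := Ordinal jn.
have wa mu : wsum mu i' i' = mu a := wsum1 mu a.
rewrite generic_dim_ge // !wa.
have pE := clattice_weakly_compatible YGr pY.
have lakY : clattice R lak `<=` Y by rewrite -EE.
(* For a single column both inequalities come from passing to the reference of eta, modulo which Y
   cap V_(a, a) is zero. *)
apply/eqP; rewrite eq_le; apply/andP; split.
  have : rdim_ge ((\rank (M i' i'))%:Z + lak a) i' i' Y p.2.
    apply: (@rdim_ge_any R n _ i' i' Y hY lak) => //.
    by exists (\rank (M i' i')); split; [rewrite wa lexx|apply/rankM].
  move=> [m [mr]] /(dim_ge_sub0 (clattice_vsub _ _)) m0.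
  rewrite wa m0 ?add0r // in mr.
  by move=> y [Yy yV]; apply: (weakly_compatible_column YGr pY (a := a)).
have : rdim_ge (p.2 a) i' i' Y lak.
  apply: (@rdim_ge_any R n _ i' i' Y hY p.2) => //.
  by exists 0%N; split; [rewrite wa add0r|apply: dim_ge0].
move=> [m [pm /rankM mr]]; rewrite wa in pm; apply: le_trans pm _.
by rewrite lerD2r lez_nat.
Qed.

(** * Fusions *)

Definition within (n : nat) (A : loop n) (i j : nat) : bool :=
  (i <= lend A)%N && (rend A <= j)%N.

Lemma sum_within_msetD (n : nat) (p q : kpicture n) (i j : nat) :
  \sum_(X : loop n | within X i j) ((p `+` q)%mset X)%:Z =
  \sum_(X : loop n | within X i j) (p X)%:Z +
  \sum_(X : loop n | within X i j) (q X)%:Z.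
Proof. by rewrite -big_split; apply: eq_bigr => X _; rewrite msetE2 PoszD. Qed.

Lemma sum_within_mset1 (n : nat) (A : loop n) (i j : nat) :
  \sum_(X : loop n | within X i j) ([mset A]%mset X)%:Z = (within A i j)%:Z.
Proof.
rewrite big_mkcond (bigD1 A) //= big1 ?addr0 => [|X /negPf ne].
  by rewrite msetnE eqxx; case: ifP.
by rewrite msetnE ne; case: ifP.
Qed.

Lemma mem_columns (n : nat) (A : loop n) (c : 'I_n) :
  (c \in columns A) = (lend A <= c <= rend A)%N.
Proof. by rewrite inE. Qed.

Lemma lend_rend (n : nat) (A : loop n) : (lend A < rend A)%N.
Proof. exact: (valP A). Qed.

Lemma overlap_ends (n : nat) (A B : loop n) : overlap A B ->
  [/\ (maxn (lend A) (lend B) <= minn (rend A) (rend B))%N &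
   (lend A < lend B)%N && (rend A < rend B)%N ||
   (lend B < lend A)%N && (rend B < rend A)%N].
Proof.
move=> /and3P[/fintype.subsetPn[a aA aB] /fintype.subsetPn[b bB bA]].
move=> /finset.set0Pn[c]; rewrite finset.in_setI => /andP[cA cB].
move: aA aB bB bA cA cB; rewrite !mem_columns => *.
by split; lia.
Qed.

Lemma union_ends (n : nat) (A B U : loop n) :
    columns U = columns A :|: columns B ->
  (lend U = minn (lend A) (lend B) :> nat) /\
  (rend U = maxn (rend A) (rend B) :> nat).
Proof.
move=> /setP UE; have h (c : 'I_n) : (lend U <= c <= rend U)%N =
    (lend A <= c <= rend A)%N || (lend B <= c <= rend B)%N.
  by have := UE c; rewrite finset.in_setU !mem_columns.
have A_ := ltnW (lend_rend A); have B_ := ltnW (lend_rend B).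
have U_ := ltnW (lend_rend U).
have : (lend U <= lend A <= rend U)%N by rewrite h leqnn A_.
have : (lend U <= rend A <= rend U)%N by rewrite h leqnn A_.
have : (lend U <= lend B <= rend U)%N by rewrite h leqnn B_ orbT.
have : (lend U <= rend B <= rend U)%N by rewrite h leqnn B_ orbT.
have := esym (h (lend U)); have := esym (h (rend U)); rewrite !leqnn U_ /=.
by move=> /orP[] /andP[? ?] /orP[] /andP[? ?] *; split; lia.
Qed.

Lemma inter_ends (n : nat) (A B D : loop n) :
    (maxn (lend A) (lend B) <= minn (rend A) (rend B))%N ->
    columns D = columns A :&: columns B ->
  (lend D = maxn (lend A) (lend B) :> nat) /\
  (rend D = minn (rend A) (rend B) :> nat).
Proof.
move=> AB /setP DE; have h (c : 'I_n) : (lend D <= c <= rend D)%N =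
    (lend A <= c <= rend A)%N && (lend B <= c <= rend B)%N.
  by have := DE c; rewrite finset.in_setI !mem_columns.
have A_ := lend_rend A; have B_ := lend_rend B.
have D_ := ltnW (lend_rend D).
have mM (c : 'I_n) : c = maxn (lend A) (lend B) :> nat -> (lend D <= c)%N.
  by move=> e; have /andP[] : (lend D <= c <= rend D)%N by rewrite h e; lia.
have mm (c : 'I_n) : c = minn (rend A) (rend B) :> nat -> (c <= rend D)%N.
  by move=> e; have /andP[] : (lend D <= c <= rend D)%N by rewrite h e; lia.
have := esym (h (lend D)); have := esym (h (rend D)); rewrite !leqnn D_ /=.
have := mM (lend A); have := mM (lend B); have := mm (rend A); have := mm (rend B).
move=> mmB mmA mMB mMA /andP[/andP[? ?] /andP[? ?]] /andP[/andP[? ?] /andP[? ?]].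
split.
  case: (leqP (lend A) (lend B)) => ?; first by have := mMB ltac:(lia); lia.
  by have := mMA ltac:(lia); lia.
case: (leqP (rend A) (rend B)) => ?; first by have := mmA ltac:(lia); lia.
by have := mmB ltac:(lia); lia.
Qed.

Lemma inter_set1 (n : nat) (A B : loop n) (c : 'I_n) :
    (maxn (lend A) (lend B) <= minn (rend A) (rend B))%N ->
    columns A :&: columns B = finset.set1 c ->
  (c = maxn (lend A) (lend B) :> nat) /\ (c = minn (rend A) (rend B) :> nat).
Proof.
move=> AB /setP DE; have h (d : 'I_n) : ((d : nat) == c) =
    (lend A <= d <= rend A)%N && (lend B <= d <= rend B)%N.
  by have := DE d; rewrite finset.in_setI !mem_columns finset.in_set1 => ->.
have A_ := lend_rend A; have B_ := lend_rend B.
have mM (d : 'I_n) : d = maxn (lend A) (lend B) :> nat -> d = c :> nat.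
  by move=> e; apply/eqP; rewrite h e; lia.
have mm (d : 'I_n) : d = minn (rend A) (rend B) :> nat -> d = c :> nat.
  by move=> e; apply/eqP; rewrite h e; lia.
have := mM (lend A); have := mM (lend B); have := mm (rend A); have := mm (rend B).
move=> mmB mmA mMB mMA; split.
  case: (leqP (lend A) (lend B)) => ?; first by have := mMB ltac:(lia); lia.
  by have := mMA ltac:(lia); lia.
case: (leqP (rend A) (rend B)) => ?; first by have := mmA ltac:(lia); lia.
by have := mmB ltac:(lia); lia.
Qed.

(** An interval containing [A] or [B] contains their intersection, and one containing both contains
    their union; so no interval loses. The intersection itself contains none of [A], [B] and [U]. *)
Lemma fusion_generic_dim (n : nat) (p q : ekpicture n) : fusion p q ->
  (forall i j, generic_dim p i j <= generic_dim q i j) /\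
  (exists i j, (j < n)%N /\ generic_dim p i j < generic_dim q i j).
Proof.
move=> [p0 [A [B [U [AB pE UE qE]]]]]; have [ABne ABcross] := overlap_ends AB.
have [lU rU] := union_ends UE.
pose x := maxn (lend A) (lend B); pose y := minn (rend A) (rend B).
(* The count is the same for both kinds of fusion: when the intersection is a single column, raising
   eta there contributes what a loop from [x] to [y] would. *)
suff main : forall i j, generic_dim q i j - generic_dim p i j =
    (within U i j)%:Z + ((i <= x) && (y <= j))%N%:Z
      - (within A i j)%:Z - (within B i j)%:Z.
  have yn : (y < n)%N by rewrite /y; have := ltn_ord (rend A); lia.
  split=> [i j|]; last first.
    exists x, y; split=> //; move: (main x y); move: ABne ABcross lU rU.
    by rewrite /within /x /y; lia.
  by move: (main i j); move: ABne ABcross lU rU; rewrite /within /x /y; lia.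
move=> i j.
have gdE (r : ekpicture n) : generic_dim r i j = wsum r.2 i j +
    \sum_(X : loop n | within X i j) (r.1 X)%:Z by [].
have sum1 (Z : loop n) := sum_within_mset1 Z i j.
have sum2 (X Y : loop n) :
  \sum_(Z : loop n | within Z i j) ([mset X; Y]%mset Z)%:Z =
    (within X i j)%:Z + (within Y i j)%:Z.
  apply: etrans (sum_within_msetD [mset X]%mset [mset Y]%mset i j) _.
  exact: (congr2 +%R (sum1 X) (sum1 Y)).
have pdim : generic_dim p i j = wsum p.2 i j +
    (\sum_(X : loop n | within X i j) (p0 X)%:Z +
     ((within A i j)%:Z + (within B i j)%:Z)).
  by rewrite gdE pE (sum_within_msetD p0) (sum2 A B).
case: qE => [[D [DE q1 q2]]|[c [cE q1 q2]]].
  have [lD rD] := inter_ends ABne DE.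
  rewrite pdim gdE q1 q2 (sum_within_msetD p0) (sum2 U D).
  rewrite [within D _ _]/within lD rD -/x -/y.
  ring.
have [cx cy] := inter_set1 ABne cE.
rewrite pdim gdE q1 q2 (sum_within_msetD p0) (sum1 U).
rewrite (wsum_delta _ c) {1}cx cy -/x -/y.
ring.
Qed.

Lemma ekp_gt_generic_dim (n : nat) (p q : ekpicture n) : ekp_gt p q ->
  exists i j, (j < n)%N /\ generic_dim p i j < generic_dim q i j.
Proof.
(* Monotonicity is carried through the induction so that one strict gain survives the remaining
   fusions. *)
move=> [pq pNq]; suff : (forall i j, generic_dim p i j <= generic_dim q i j) /\
  (p = q \/ exists i j, (j < n)%N /\ generic_dim p i j < generic_dim q i j).
  by move=> [_ [//|]].
elim: pq {pNq} => {p q} [p q /fusion_generic_dim[h1 h2]|p|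
    p q r _ [le1 eq1] _ [le2 eq2]].
- by split=> //; right.
- by split=> //; left.
split=> [i j|]; first exact: le_trans (le1 i j) (le2 i j).
case: eq1 => [-> //|[i [j [jn lt]]]]; right; exists i, j; split=> //.
exact: lt_le_trans lt (le2 i j).
Qed.

Lemma generic_dim_add (n : nat) (p q : ekpicture n) (i j : nat) :
  generic_dim (ekp_add p q) i j = generic_dim p i j + generic_dim q i j.
Proof.
rewrite /generic_dim sum_within_msetD addrACA; congr (_ + _).
by rewrite -big_split; apply: eq_bigr => a _; rewrite ffunE.
Qed.

(** * Convolution *)

Lemma sum_setT_finite (T : choiceType) (M : nmodType) (r : seq T) (f : T -> M) :
  uniq r -> (forall i, i \notin r -> f i = 0) ->
  \sum_(i \in [set: T]) f i = \sum_(i <- r) f i.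
Proof.
move=> ur f0; rewrite (fsbigE r) // => [|i _ /f0 //].
by apply: eq_bigl => i; rewrite in_setT.
Qed.

(** * Multiplication by powers of t - s, and tau_s *)

Section SupportTsub.
Variables (R : realType) (n : nat) (s : R[i]).
Implicit Types (f g : formal R n).

(** Exponents bounded above by [B], which makes the sum in [tsub_inv] finite at each exponent,
    together with the coefficient at [B]. *)
Definition top_coef (B : int) f (u : 'rV[R[i]]_n) : Prop :=
  (forall m : int, B < m -> f m = 0) /\ f B = u.

Lemma tsub_linear : linear (tsub (n := n) s).
Proof.
move=> a f g; apply/funext=> m.
rewrite /tsub !formalD !formalZ /tsub scalerDr scalerBr opprD !scalerA.
by rewrite [s * a]mulrC addrACA.
Qed.

HB.instance Definition _ := GRing.isLinear.Build R[i] (formal R n) (formal R n)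
  *:%R (tsub s) tsub_linear.

Lemma iter_tsubP k (a : R[i]) f g :
  iter k (tsub s) (a *: f + g) = a *: iter k (tsub s) f + iter k (tsub s) g.
Proof. by elim: k => //= k ->; rewrite linearP. Qed.

(** At t = 0 the factor t - s takes the value -s, so the lowest term is only rescaled; for s <> 0
    the order of the pole is preserved. *)
Lemma iter_tsub_low k f (l : int) :
    (forall m : int, m < l -> f m = 0) ->
  (forall m : int, m < l -> iter k (tsub s) f m = 0) /\
  iter k (tsub s) f l = (- s) ^+ k *: f l.
Proof.
move=> f0; elim: k => [|k [IH1 IH2]]; first by rewrite expr0 scale1r.
split=> [m ml|]; rewrite /= /tsub.
  by rewrite !IH1 ?scaler0 ?subr0 //; lia.
rewrite IH1; last by lia.
by rewrite IH2 sub0r scalerA -scaleNr exprS mulNr.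
Qed.

Lemma tsub_top B f u : top_coef B f u -> top_coef (B + 1) (tsub s f) u.
Proof.
move=> [f0 fB]; split=> [m hm|]; rewrite /tsub.
  by rewrite !f0 ?scaler0 ?subr0 //; lia.
by rewrite addrK fB f0 ?scaler0 ?subr0 //; lia.
Qed.

Lemma tsub_invE (N : nat) f (m : int) :
    (forall l : int, m + 1 + N%:Z <= l -> f l = 0) ->
  tsub_inv s f m = \sum_(a < N) s ^+ a *: f (m + 1 + a%:Z).
Proof.
move=> f0; rewrite /tsub_inv (sum_setT_finite (iota_uniq 0 N)).
  by rewrite -[X in iota 0 X]subn0 -/(index_iota 0 N) big_mkord.
move=> a; rewrite mem_iota /= add0n -leqNgt => Na.
by rewrite f0 ?scaler0 //; lia.
Qed.

Lemma tsub_inv_top B f u : top_coef B f u -> top_coef (B - 1) (tsub_inv s f) u.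
Proof.
move=> [f0 fB]; split=> [m hm|].
  by rewrite (@tsub_invE 0) ?big_ord0 // => l hl; apply: f0; lia.
rewrite (@tsub_invE 1) => [|l hl]; last by apply: f0; lia.
by rewrite big_ord1 expr0 scale1r addr0 subrK fB.
Qed.

Lemma tsub_invK B f u : top_coef B f u -> tsub s (tsub_inv s f) = f.
Proof.
move=> [f0 _]; apply/funext=> m; rewrite /tsub.
pose N := (absz (B - m)%R).+1.
(* The sum at [m - 1] has one more term than the sum at [m]. That first term is [f m]; the others
   cancel as in a geometric series. *)
rewrite (@tsub_invE N.+1) => [|l hl]; last by apply: f0; lia.
rewrite (@tsub_invE N) => [|l hl]; last by apply: f0; lia.
rewrite big_ord_recl /= expr0 scale1r subrK addr0 scaler_sumr.
rewrite -addrA -sumrB big1 ?addr0 // => a _.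
rewrite scalerA -exprS; apply/eqP; rewrite subr_eq0; apply/eqP.
by congr (_ *: f _); rewrite /bump /=; lia.
Qed.

Lemma tsub_col f (a : 'I_n) :
  (forall m, f m 0 a = 0) -> forall m, tsub s f m 0 a = 0.
Proof. by move=> f0 m; rewrite /tsub !mxE !f0 mulr0 subr0. Qed.

Lemma tsub_inv_col B f u (a : 'I_n) :
  top_coef B f u -> (forall m, f m 0 a = 0) ->
  forall m, tsub_inv s f m 0 a = 0.
Proof.
move=> [fB _] f0 m; rewrite (@tsub_invE (absz (B - m)%R).+1) => [|l hl].
  by rewrite summxE big1 // => l _; rewrite mxE f0 mulr0.
by apply: fB; lia.
Qed.

Let e (i : 'I_n) : formal R n := tbasis R 0 i.

Lemma tsub_exp_top (j : int) i :
  top_coef j (tsub_exp s j (e i)) (delta_mx 0 i).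
Proof.
have e_top : top_coef 0 (e i) (delta_mx 0 i).
  split=> [m hm|]; last by rewrite /e /tbasis eqxx.
  by rewrite /e /tbasis; case: eqP => // m0; rewrite m0 ltxx in hm.
case: j => d; rewrite /tsub_exp.
  elim: d => [//|d IH]; rewrite iterS.
  by have := tsub_top IH; congr top_coef; lia.
elim: d => [|d IH]; rewrite iterS.
  by have := tsub_inv_top e_top; congr top_coef; lia.
by have := tsub_inv_top IH; congr top_coef; lia.
Qed.

Lemma tsub_exp_col (j : int) (i a : 'I_n) m :
  a != i -> tsub_exp s j (e i) m 0 a = 0.
Proof.
move=> ai; have e0 l : e i l 0 a = 0 by rewrite tbasisE (negPf ai) andbF.
case: j => d; rewrite /tsub_exp.
  by elim: d m => [//|d IH] m; rewrite iterS; apply: tsub_col.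
elim: d m => [|d IH] m; rewrite iterS.
  exact: tsub_inv_col (tsub_exp_top 0 i) e0 m.
exact: tsub_inv_col (tsub_exp_top (Negz d) i) IH m.
Qed.

(** The product (t - s)^(k + j) e_i is polynomial in t, since k + j >= 0. *)
Lemma iter_tsub_exp_low (k : nat) (j : int) i (m : int) :
  - k%:Z <= j -> m < 0 -> iter k (tsub s) (tsub_exp s j (e i)) m = 0.
Proof.
have e0 (l : int) : l < 0 -> e i l = 0.
  by move=> l0; rewrite /e /tbasis; case: eqP => // h; rewrite h ltxx in l0.
case: j => d kd m0; rewrite /tsub_exp.
  by rewrite -iterD; apply: (proj1 (iter_tsub_low _ e0)).
have [c kE] : exists c, k = (c + d.+1)%N by exists (k - d.+1)%N; lia.
rewrite kE iterD.
suff -> : iter d.+1 (tsub s) (iter d.+1 (tsub_inv s) (e i)) = e i.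
  exact: (proj1 (iter_tsub_low _ e0)).
elim: (d) => [|d' IH]; first exact: tsub_invK (tsub_exp_top 0 i).
rewrite iterSr [iter d'.+2 (tsub_inv s) _]iterS.
by rewrite (tsub_invK (tsub_exp_top (Negz d') i)).
Qed.

Definition fin_supp f : Prop :=
  exists K : nat, forall m : int, m < - K%:Z \/ K%:Z <= m -> f m = 0.

Lemma fin_supp_vsub : vsubspace fin_supp.
Proof.
split=> [|a f g [K hK] [K' hK']]; first by exists 0%N.
exists (K + K')%N => m hm; rewrite formalD formalZ hK ?hK' ?scaler0 ?addr0 //.
  by case: hm => *; [left|right]; lia.
by case: hm => *; [left|right]; lia.
Qed.

Lemma tau_expand (K : nat) f :
    (forall m : int, m < - K%:Z \/ K%:Z <= m -> f m = 0) ->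
  tau s f = \sum_(l < 2 * K) \sum_i
     f (l%:Z - K%:Z) 0 i *: tsub_exp s (l%:Z - K%:Z) (e i).
Proof.
move=> f0; rewrite /tau.
pose r := [seq l%:Z - K%:Z | l <- index_iota 0 (2 * K)].
rewrite (@sum_setT_finite _ _ r).
- by rewrite big_map big_mkord.
- rewrite map_inj_uniq ?iota_uniq // => l l' /addIr.
  by case.
move=> j jr; rewrite big1 // => i _.
have [h1|h1] := ltP j (- K%:Z); first by rewrite f0 ?mxE ?scale0r //; left.
have [h2|h2] := leP K%:Z j; first by rewrite f0 ?mxE ?scale0r //; right.
case/mapP: jr; exists (absz (j + K%:Z)%R); first by rewrite mem_index_iota; lia.
by lia.
Qed.

(** The sum over all integers in [tau] takes a default value on infinite supports, so both vectors
    are first expanded over a common finite range. *)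
Lemma tau_linear a f g : fin_supp f -> fin_supp g ->
  tau s (a *: f + g) = a *: tau s f + tau s g.
Proof.
move=> [K hK] [K' hK'].
have fK (m : int) : m < - (K + K')%N%:Z \/ (K + K')%N%:Z <= m -> f m = 0.
  by move=> hm; apply: hK; case: hm => *; [left|right]; lia.
have gK (m : int) : m < - (K + K')%N%:Z \/ (K + K')%N%:Z <= m -> g m = 0.
  by move=> hm; apply: hK'; case: hm => *; [left|right]; lia.
rewrite (tau_expand fK) (tau_expand gK) (@tau_expand (K + K')); last first.
  by move=> m hm; rewrite formalD formalZ fK // gK // scaler0 addr0.
rewrite scaler_sumr -big_split; apply: eq_bigr => l _ /=.
rewrite scaler_sumr -big_split; apply: eq_bigr => i _ /=.
by rewrite !mxE scalerDl scalerA.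
Qed.

Lemma tau0 : tau s (0 : formal R n) = 0.
Proof.
rewrite (@tau_expand 0) => [|m _]; last by rewrite formal0.
by rewrite big_ord0.
Qed.

Lemma tau_sum m (c : 'rV[R[i]]_m) (z : 'I_m -> formal R n) :
    (forall l, fin_supp (z l)) ->
  tau s (\sum_l c 0 l *: z l) = \sum_l c 0 l *: tau s (z l).
Proof.
move=> hz; suff [_ //] : fin_supp (\sum_l c 0 l *: z l) /\
  tau s (\sum_l c 0 l *: z l) = \sum_l c 0 l *: tau s (z l).
apply: (big_rec2 (fun f g => fin_supp f /\ tau s f = g)) => [|l f g _ [hf <-]].
  by split; [exact: vsub0 fin_supp_vsub|exact: tau0].
split; first exact: (proj2 fin_supp_vsub).
exact: tau_linear.
Qed.

Lemma tau_Vset (i j : nat) f :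
  fin_supp f -> Vset R i j f -> Vset R i j (tau s f).
Proof.
move=> [K hK] fV m a aij; rewrite (tau_expand hK) formal_sumE big1 // => l _.
rewrite formal_sumE big1 // => b _; rewrite formalZ mxE.
have [->|ne] := eqVneq b a; first by rewrite fV ?mul0r.
by rewrite tsub_exp_col ?mulr0 // eq_sym.
Qed.

Lemma iter_tsub_tau_low (K : nat) f (m : int) :
    (forall l : int, l < - K%:Z \/ K%:Z <= l -> f l = 0) -> m < 0 ->
  iter K (tsub s) (tau s f) m = 0.
Proof.
move=> hK m0; rewrite (tau_expand hK).
pose S : set (formal R n) := [set g | iter K (tsub s) g m = 0].
have hS : vsubspace S.
  split=> [|a g h /= gS hS]; rewrite /S /=.
    suff -> : iter K (tsub s) (0 : formal R n) = 0 by [].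
    by elim: (K) => //= k ->; apply: linear0.
  by rewrite iter_tsubP formalD formalZ gS hS scaler0 addr0.
apply: (vsub_sum (S := S)) => // l _; apply: vsub_sum => // i _.
apply: vsubZ => //; apply: iter_tsub_exp_low => //.
by rewrite lerBrDr addNr.
Qed.

(** The coefficient of tau_s(f) at t^l is [f l]: powers (t - s)^j with j < l do not reach t^l, those
    with l < j < 0 have zero coefficient in [f], and those with j >= 0 are polynomial. *)
Lemma tau_top f (l : int) :
    fin_supp f -> (forall m : int, l < m -> m < 0 -> f m = 0) -> l < 0 ->
    (forall m : int, m < 0 -> tau s f m = 0) ->
  f l = 0.
Proof.
move=> [K hK] f0 l0 tau_low; have := tau_low l l0.
have [lK|Kl] := ltP l (- K%:Z); first by move=> _; apply: hK; left.
have lt_l : (absz (l + K%:Z)%R < 2 * K)%N.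
  by lia.
rewrite (tau_expand hK) formal_sum (bigD1 (Ordinal lt_l)) //=.
rewrite [X in _ + X]big1 ?addr0.
  rewrite gez0_abs ?addrK; last by lia.
  rewrite formal_sum => h; apply/rowP=> a; move/rowP: h => /(_ a).
  rewrite !mxE summxE (bigD1 a) //= big1 ?addr0 => [|b ne].
    rewrite formalZ mxE (proj2 (tsub_exp_top l a)) mxE !eqxx mulr1; exact.
  rewrite formalZ mxE (proj2 (tsub_exp_top l b)) mxE eq_sym (negPf ne) andbF.
  by rewrite mulr0.
move=> x ne; rewrite formal_sum big1 // => i _; rewrite formalZ.
have [xl|lx] := ltP (x%:Z - K%:Z) l.
  by rewrite (proj1 (tsub_exp_top _ i)) ?scaler0.
have [x0|x0] := ltP (x%:Z - K%:Z) 0.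
  rewrite f0 ?mxE ?scale0r // lt_neqAle lx andbT; apply: contra ne => /eqP e1.
  apply/eqP/val_inj => /=; rewrite e1; lia.
have xK : - 0%N%:Z <= x%:Z - K%:Z by rewrite oppr0.
by have /= -> := iter_tsub_exp_low i xK l0; rewrite scaler0.
Qed.

End SupportTsub.

Lemma X0P (R : realType) (n : nat) (f : formal R n) :
  X0 R n f <-> (exists K : nat, forall m : int, K%:Z <= m -> f m = 0) /\
               (forall m : int, m < 0 -> f m = 0).
Proof.
rewrite /X0 clatticeP; split=> -[hK f0]; split=> //.
  by move=> m m0; apply/rowP=> a; rewrite mxE f0 // ffunE oppr0.
by move=> m a; rewrite ffunE oppr0 => /f0 ->; rewrite mxE.
Qed.

Lemma tX0_fin_supp (R : realType) (n : nat) (d : int) (f : formal R n) :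
  tX0 R n d f -> fin_supp f.
Proof.
rewrite tX0E => /clatticeP[[K hK] flow]; exists (K + absz d)%N => m [hm|hm].
  by apply/rowP=> a; rewrite mxE flow // ffunE opprK; lia.
by apply: hK; lia.
Qed.

(* Multiplication by a power of [t - s] clears the poles of [tau s z] without
   changing the order of the pole of [y] at [0]. *)
Lemma tau_separated (R : realType) (n : nat) (s : R[i]) (y z : formal R n) :
    s != 0 -> fin_supp y -> fin_supp z -> X0 R n (y + tau s z) ->
  X0 R n y /\ X0 R n z.
Proof.
move=> s0 [B hB] hz /X0P[_ low]; have [K hK] := hz.
have iter_low (m : int) : m < 0 -> iter K (tsub s) y m = 0.
  move=> m0; have -> : iter K (tsub s) y =
      (-1) *: iter K (tsub s) (tau s z) + iter K (tsub s) (y + tau s z).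
    by rewrite -iter_tsubP scaleN1r [- _ + _]addrC addrK.
  rewrite formalD formalZ (iter_tsub_tau_low s hK m0) scaler0 add0r.
  by apply: (proj1 (iter_tsub_low s K low)).
(* Upward from -B: the lowest term of [y] is multiplied by (-s)^K, which is nonzero. *)
have y0 (m : int) : m < 0 -> y m = 0.
  have [N] := ubnP (absz (m + B%:Z)%R); elim: N m => // N IH m mN m0.
  have [mB|Bm] := ltP m (- B%:Z); first by apply: hB; left.
  have ylow (l : int) : l < m -> y l = 0.
    move=> lm; have [lB|Bl] := ltP l (- B%:Z); first by apply: hB; left.
    by apply: IH; lia.
  have [_] := iter_tsub_low s K ylow; rewrite iter_low // => /esym/eqP.
  by rewrite scaler_eq0 expf_eq0 oppr_eq0 (negPf s0) andbF => /eqP.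
split; first by apply/X0P; split=> //; exists B => m hm; apply: hB; right.
have tau_low (m : int) : m < 0 -> tau s z m = 0.
  by move=> m0; have := low m m0; rewrite formalD y0 // add0r.
apply/X0P; split; first by exists K => m hm; apply: hK; right.
(* Downward from exponent -1, each time removing the leading polar term of [z]. *)
move=> m; have [N] := ubnP (absz m); elim: N m => // N IH m mN m0.
by apply: (tau_top hz _ m0 tau_low) => l ml l0; apply: IH; lia.
Qed.

Lemma dim_ge_convolution (R : realType) (n : nat) (s : R[i]) (i j k m1 m2 : nat)
    (Y1 Y2 : set (formal R n)) :
    s != 0 ->
    X0 R n `<=` Y1 -> Y1 `<=` tX0 R n (- k%:Z) ->
    X0 R n `<=` Y2 -> Y2 `<=` tX0 R n (- k%:Z) ->
    dim_ge (Y1 `&` Vset R i j) (X0 R n) m1 ->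
    dim_ge (Y2 `&` Vset R i j) (X0 R n) m2 ->
  dim_ge (sumset Y1 (tau s @` Y2) `&` Vset R i j) (X0 R n) (m1 + m2).
Proof.
move=> s0 Y1X Y1k Y2X Y2k [v [vY v_free]] [w [wY w_free]].
have X00 : X0 R n 0 by apply: vsub0; apply: clattice_vsub.
have hv l : fin_supp (v l) by apply/tX0_fin_supp/Y1k; have [] := vY l.
have hw l : fin_supp (w l) by apply/tX0_fin_supp/Y2k; have [] := wY l.
exists (fun x : 'I_(m1 + m2) =>
  match fintype.split x with inl l => v l | inr l => tau s (w l) end).
split=> [x|c].
  case: (fintype.split x) => l.
    have [Yl Vl] := vY l; split=> //; exists (v l) => //.
    by exists 0; [exists 0; [exact: Y2X|exact: tau0]|rewrite addr0].
  have [Yl Vl] := wY l; split; last exact: tau_Vset.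
  exists 0; first exact: Y1X.
  by exists (tau s (w l)); [exists (w l)|rewrite add0r].
pose c1 : 'rV_m1 := lsubmx c; pose c2 : 'rV_m2 := rsubmx c.
rewrite big_split_ord /=.
have -> : \sum_(l < m1) c 0 (lshift m2 l) *:
    match fintype.split (lshift m2 l) with
    | inl l => v l | inr l => tau s (w l) end =
    \sum_l c1 0 l *: v l.
  by apply: eq_bigr => l _; rewrite (unsplitK (inl l)) mxE.
have -> : \sum_(l < m2) c 0 (rshift m1 l) *:
    match fintype.split (rshift m1 l) with
    | inl l => v l | inr l => tau s (w l) end =
    tau s (\sum_l c2 0 l *: w l).
  rewrite tau_sum //.
  by apply: eq_bigr => l _; rewrite (unsplitK (inr l)) mxE.
have hs := @fin_supp_vsub R n.
have hsv : fin_supp (\sum_l c1 0 l *: v l).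
  by apply: (vsub_sum (S := @fin_supp R n)) => // l _; apply: vsubZ.
have hsw : fin_supp (\sum_l c2 0 l *: w l).
  by apply: (vsub_sum (S := @fin_supp R n)) => // l _; apply: vsubZ.
move=> /(tau_separated s0 hsv hsw)[/v_free c10 /w_free c20].
by rewrite -[c]hsubmxK -/c1 -/c2 c10 c20 row_mx0.
Qed.

(** * Semicontinuity on the Beilinson-Drinfeld family *)

(** Expanded in 1/t, the frame vector t^(l-k) (t-s)^(-k) e_i has leading term t^(l-2k) e_i for every
    s, including s = 0. *)
Lemma BD_frame_triangular (R : realType) (n k : nat) (s : R[i]) :
  triangular (2 * k)%N%:Z (X0 R n) (@BD_frame R n k s).
Proof.
split=> [x m a ax|x m hm|x|f l a /X0P[_ f0]].
- by rewrite /BD_frame /tpow tsub_exp_col.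
- rewrite /BD_frame /tpow (proj1 (tsub_exp_top _ (- k%:Z) _)) //.
  by move: hm; generalize (x.2 : nat) => l; lia.
- rewrite /BD_frame /tpow.
  have -> : x.2%:Z - (2 * k)%N%:Z - x.2%:Z - - k%:Z = - k%:Z by lia.
  by rewrite (proj2 (tsub_exp_top _ _ _)) mxE !eqxx.
by rewrite f0 ?mxE //; have := ltn_ord l; lia.
Qed.

(** All fibers share the reference X_0, and the equations do not involve the variable [None]; this
    is what carries the bound from s <> 0 to s = 0. The inclusion of X_0 is recorded for the final
    comparison. *)
Lemma BD_dim_closed (R : realType) (n k : nat) (d : int) (i j : nat) :
  zclosed (BD_atlas R n k)
    [set z | X0 R n `<=` z.2 /\ exists m : nat, d <= m%:Z /\
               dim_ge (z.2 `&` Vset R i j) (X0 R n) m].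
Proof.
move=> J /=.
have [E hE] := @chart_rank_closed R[i] n _ J _ Some i j (#|J|%:Z + 1 - d).
exists E => v; rewrite -hE {E hE}.
have hX0 : vsubspace (X0 R n) by apply: clattice_vsub.
have tri := @BD_frame_triangular R n k (v None).
split=> [[_ [m [dm]]] /(chart_dim_ge _ _ _ _ hX0 tri) mr|lt_r].
  have aux (m0 r c : nat) :
    d <= m0%:Z -> (m0 + r <= c)%N -> r%:Z < c%:Z + 1 - d by lia.
  exact: aux dm mr.
split; first exact: chart_space_sub.
have aux (r c : nat) : (r <= c)%N -> r%:Z < c%:Z + 1 - d -> d <= (c - r)%N%:Z.
  by lia.
have rJ := rank_leq_row (chart_mx (fun z => v (Some z))
                           *m outside_mx R[i] n (2 * k) i j).
exists (#|J| - \rank (chart_mx (fun z => v (Some z))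
                           *m outside_mx R[i] n (2 * k) i j))%N.
split; first exact: aux rJ lt_r.
by apply/(chart_dim_ge _ _ _ _ hX0 tri); rewrite subnK.
Qed.

(** * Shifts by coweights and the final comparison *)

Lemma cwshiftK (R : realType) (n : nat) (nu : coweight n) (f : formal R n) :
  cwshift (- nu) (cwshift nu f) = f.
Proof.
apply/funext=> m; apply/rowP=> a; rewrite !mxE !ffunE.
by rewrite subrK.
Qed.

Lemma cwshift_clattice (R : realType) (n : nat) (nu la : coweight n)
    (f : formal R n) :
  clattice R la f -> clattice R (la + nu) (cwshift nu f).
Proof.
move=> /clatticeP[[K hK] f0]; apply/clatticeP; split.
  exists (K + \sum_a `|nu a|)%N => m hm; apply/rowP=> a; rewrite !mxE hK ?mxE //.
  have : (`|nu a| <= \sum_a `|nu a|)%N by rewrite (bigD1 a) //= leq_addr.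
  by lia.
by move=> m a; rewrite !mxE !ffunE opprD ltrBrDr => hm; apply: f0.
Qed.

Lemma cwshift_clatticeE (R : realType) (n : nat) (nu la : coweight n)
    (f : formal R n) :
  clattice R (la + nu) (cwshift nu f) -> clattice R la f.
Proof.
by move=> /(@cwshift_clattice R n (- nu)); rewrite cwshiftK addrK.
Qed.

Lemma dim_ge_cwshift (R : realType) (n : nat) (nu la : coweight n) (i j m : nat)
    (Y : set (formal R n)) :
  dim_ge (Y `&` Vset R i j) (clattice R la) m ->
  dim_ge ((cwshift nu @` Y) `&` Vset R i j) (clattice R (la + nu)) m.
Proof.
move=> [v [Yv v_free]]; exists (fun l => cwshift nu (v l)); split=> [l|c hc].
  have [Yl Vl] := Yv l; split; first by exists (v l).
  by move=> l' a aij; rewrite mxE Vl.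
apply: v_free; apply: (@cwshift_clatticeE R n nu).
have -> : cwshift nu (\sum_l c 0 l *: v l) = \sum_l c 0 l *: cwshift nu (v l).
  apply/funext=> l'; apply/rowP=> a; rewrite formal_sumE mxE formal_sumE.
  by apply: eq_bigr => l _; rewrite !formalZ !mxE.
exact: hc.
Qed.

Lemma wsumN (n : nat) (la : coweight n) (i j : nat) :
  wsum (- la) i j = - wsum la i j.
Proof. by rewrite /wsum -sumrN; apply: eq_bigr => a _; rewrite ffunE. Qed.

Lemma wsumD (n : nat) (la mu : coweight n) (i j : nat) :
  wsum (la + mu) i j = wsum la i j + wsum mu i j.
Proof. by rewrite /wsum -big_split; apply: eq_bigr => a _; rewrite ffunE. Qed.

Lemma MVcycle_rdim_ge (R : realType) (n : nat) (p : ekpicture n) (i j : nat)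
    (la : coweight n) (Y : set (formal R n)) :
  (j < n)%N -> MVcycle R p Y -> rdim_ge (generic_dim p i j) i j Y la.
Proof.
move=> jn hY.
suff : [set Y | forall la, rdim_ge (generic_dim p i j) i j Y la] Y by apply.
apply: hY; split; first exact: rdim_ge_closed.
by move=> Z [ZGr Zp] mu; have [] := weakly_compatible_dim i mu ZGr Zp jn.
Qed.

(** The empty set is closed, with equation 1 = 0, so the closure of the empty set is empty. This
    supplies the lattice at which M(r) is tested. *)
Lemma MVcycle_nonempty (R : realType) (n : nat) (p : ekpicture n) :
  MVcycle R p !=set0 -> exists Y, is_lattice Y /\ weakly_compatible (R := R) p Y.
Proof.
move=> [Y hY]; apply/not_existsP => none; apply: (hY set0); split.
  move=> J; exists [set f : polys R[i] (chart_var J) | f = 1] => v.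
  split=> [[]|/(_ 1 erefl)]; rewrite /peval rmorph1 => /eqP.
  by rewrite oner_eq0.
by move=> Z [ZGr Zp]; apply: (none Z).
Qed.

Lemma shifted_dim_ge (R : realType) (n : nat) (p : ekpicture n)
    (nu : coweight n) (i j : nat) (Y : set (formal R n)) :
    (j < n)%N -> shift_family nu (MVcycle R p) Y ->
  exists m : nat, generic_dim p i j + wsum nu i j <= m%:Z /\
    dim_ge (Y `&` Vset R i j) (X0 R n) m.
Proof.
move=> jn [Z hZ <-]; have [m [pm]] := MVcycle_rdim_ge i (- nu) jn hZ.
move=> /(dim_ge_cwshift nu); rewrite addNr => Zm.
by exists m; split=> //; rewrite wsumN in pm; lia.
Qed.

Lemma conv_family_dim_ge (R : realType) (n : nat) (p q : ekpicture n)
    (alpha beta : coweight n) (k i j : nat) z :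
    in_bounds k (shift_family alpha (MVcycle R p)) ->
    in_bounds k (shift_family beta (MVcycle R q)) ->
    (j < n)%N ->
    conv_family k (shift_family alpha (MVcycle R p))
                  (shift_family beta (MVcycle R q)) z ->
  X0 R n `<=` z.2 /\ exists m : nat,
    generic_dim (ekp_add p q) i j + wsum (alpha + beta) i j <= m%:Z /\
    dim_ge (z.2 `&` Vset R i j) (X0 R n) m.
Proof.
move=> hp hq jn hz.
suff : [set z | X0 R n `<=` z.2 /\ exists m : nat,
    generic_dim (ekp_add p q) i j + wsum (alpha + beta) i j <= m%:Z /\
    dim_ge (z.2 `&` Vset R i j) (X0 R n) m] z by [].
apply: hz; split; first exact: BD_dim_closed.
move=> {z} [s Z] /= [/eqP s0 [Y1 [Y2 [Y1p Y2q ->]]]].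
have [Y1X Y1k] := hp _ Y1p; have [Y2X Y2k] := hq _ Y2q.
split=> [f Xf|].
  exists f; first exact: Y1X.
  exists 0; last by rewrite addr0.
  exists 0; last exact: tau0.
  by apply: Y2X; apply: vsub0; apply: clattice_vsub.
have [m1 [pm1 Y1m]] := shifted_dim_ge i jn Y1p.
have [m2 [qm2 Y2m]] := shifted_dim_ge i jn Y2q.
exists (m1 + m2)%N; split; first by rewrite generic_dim_add wsumD; lia.
exact: dim_ge_convolution s0 Y1X Y1k Y2X Y2k Y1m Y2m.
Qed.

Theorem proposition3p2 (R : realType) (n : nat) (p q r : ekpicture n)
    (alpha beta : coweight n) (k : nat)
    (hp : in_bounds k (shift_family alpha (MVcycle R p)))
    (hq : in_bounds k (shift_family beta (MVcycle R q)))
    (hr : ekp_gt r (ekp_add p q)) :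
  conv_coef k (shift_family alpha (MVcycle R p))
              (shift_family beta (MVcycle R q))
              (shift_family (alpha + beta) (MVcycle R r)) = 0%E.
Proof.
rewrite /conv_coef; case: asboolP => // -[[K0sub [K0ne _] _] _]; exfalso.
have [Y [YGr Yr]] : exists Y, is_lattice Y /\ weakly_compatible (R := R) r Y.
  apply: MVcycle_nonempty; have [_ [_ [Z hZ _] _]] := K0ne.
  by exists Z.
have [i [j [jn lt_rpq]]] := ekp_gt_generic_dim hr.
pose nu := alpha + beta.
have : conv_fiber0 k (shift_family alpha (MVcycle R p))
    (shift_family beta (MVcycle R q)) (0, cwshift nu @` Y).
  apply: K0sub; exists (cwshift nu @` Y) => //; exists Y => //.
  by move=> Z [_]; apply; split.
move=> [/(conv_family_dim_ge i hp hq jn)[/= XY [m [dm Ym]]] _].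
(* Shifting back by [nu] turns the bound in the fiber, relative to X_0, into one for [Y] relative to
   [- nu], where the value attached to [r] is an upper bound. *)
have [_ /(_ m)] := weakly_compatible_dim i (- nu) YGr Yr jn.
have Yshift : cwshift (- nu) @` (cwshift nu @` Y) = Y.
  rewrite image_comp; apply/seteqP; split=> f.
    by move=> [g Yg <-]; rewrite /= cwshiftK.
  by move=> Yf; exists f => //=; rewrite cwshiftK.
have := dim_ge_cwshift (- nu) Ym; rewrite Yshift add0r => Ym' /(_ _ Ym').
(* The inclusion of X_0 in the shifted lattice is the inclusion in [Y] that the upper bound
   requires. *)
rewrite wsumN => h; have /h : clattice R (- nu) `<=` Y.
  move=> f /(@cwshift_clattice R n nu); rewrite addNr => /XY[g Yg].
  by move=> /(congr1 (cwshift (- nu))); rewrite !cwshiftK => <-.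
by move: dm lt_rpq; rewrite -/nu; lia.
Qed.
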